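(* Let $\mathfrak g=\mathfrak q(n)$ and let $V=\Bbbk^{n|n}$ be its defining representation. Let $x\in\mathfrak g_{\bar 1}$ be a distinguished odd element and let $\frac12[x,x]=s+f$ be the Jordan decomposition of $\frac12[x,x]$ in $\mathfrak g_{\bar 0}$ ($s$ semisimple, $f$ nilpotent). Then: (1) $s=\lambda\,\mathrm{Id}_V$ for some $\lambda\in\Bbbk$. (2) If $s\ne0$, then $f$ is a principal nilpotent element of $\mathfrak g_{\bar 0}$. Considering a principal $\mathfrak{sl}_2$-triple $(e,h,f)$ in $\mathfrak g_{\bar 0}$, we have a decomposition $x=\sum_{i=0}^{n-1}x_{-2i}$ such that $[h,x_j]=jx_j$ for every $j$. (3) If $s=0$, then $V$ decomposes into a direct sum of two indecomposable $\Bbbk[x]$-modules $W\oplus\Pi W$. In that case, $x$ is neat if $n$ is odd, and $x$ is balanced if $n$ is even.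
   Context: Base field $\Bbbk$: algebraically closed of characteristic $0$. $\mathfrak q(n)\subset\mathfrak{gl}(n|n)$ is the Lie sub-superalgebra centralizing a parity-switching isomorphism of $\Bbbk^{n|n}$; concretely it consists of block matrices $\begin{pmatrix} A & B \\ B & A \end{pmatrix}$ with $A,B\in\mathfrak{gl}_n$, so $\mathfrak q(n)_{\bar 0}\cong\mathfrak{gl}_n$. The corresponding supergroup $G=Q(n)$ has $G_{\bar 0}=GL_n$. ''$\Bbbk[x]$-module'' means a $\mathbb Z/2$-graded module with the action of the odd operator $x$; $\Pi$ is parity change. Semisimple and nilpotent elements are those of the reductive Lie algebra $\mathfrak g_{\bar 0}$ (central elements are semisimple). A principal nilpotent is a regular nilpotent (for $n=1$ it is $0$, with zero triple). $\mathfrak{sl}_2$-triples satisfy $[h,e]=2e$, $[h,f]=-2f$, $[e,f]=h$. An element $x\in\mathfrak g_{\bar 1}$ is distinguished if every semisimple element of $\mathfrak g_{\bar 0}$ commuting with $x$ lies in $Z(\mathfrak g)_{\bar 0}$, where $Z(\mathfrak g)$ is the center of $\mathfrak g$. For $x$ with $s=0$: $x$ is neat (resp. balanced) if for every $M\in\mathrm{Rep}(G)$ (finite-dimensional $\mathfrak g$-modules whose $\mathfrak g_{\bar 0}$-action integrates to $G_{\bar 0}$), all Jordan blocks of the nilpotent operator $x|_M$ have odd size (resp. each Jordan block has size $1$ or even size). *)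

(* Defs.v *)
From HB Require Import structures.
From mathcomp Require Import all_boot all_order all_algebra.
From mathcomp Require Import mpoly.

Set Implicit Arguments.
Unset Strict Implicit.
Unset Printing Implicit Defensive.

Import GRing.Theory.
Local Open Scope ring_scope.

(* The space k^(p|q) consists of column vectors, the first p coordinates being
   even and the last q odd; gl(p|q) is 'M_(p + q) acting on the left.
   Parities are booleans: false is even, true is odd. *)

Section SuperMatrices.
Variable k : fieldType.

Definition hpart p q (b : bool) (X : 'M[k]_(p + q)) : 'M[k]_(p + q) :=
  if b then block_mx 0 (ursubmx X) (dlsubmx X) 0
  else block_mx (ulsubmx X) 0 0 (drsubmx X).

Definition has_parity p q (b : bool) (X : 'M[k]_(p + q)) : Prop := hpart b X = X.

(* Bilinear extension of [X, Y] = X Y - (-1)^(|X||Y|) Y X. *)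
Definition sbracket p q (X Y : 'M[k]_(p + q)) : 'M[k]_(p + q) :=
  \sum_(a : bool) \sum_(b : bool)
    (hpart a X *m hpart b Y - (-1) ^+ (a && b) *: (hpart b Y *m hpart a X)).

Definition queer n (X : 'M[k]_(n + n)) : Prop :=
  exists A B : 'M[k]_n, X = block_mx A B B A.

Definition queer_center n (Z : 'M[k]_(n + n)) : Prop :=
  queer Z /\ forall Y, queer Y -> sbracket Z Y = 0.

(* For X in q(n)_0 the block [ulsubmx X] is the image of X under
   q(n)_0 = gl_n; the next three notions are those of gl_n. *)
Definition queer_even_semisimple n (X : 'M[k]_(n + n)) : Prop :=
  [/\ queer X, has_parity false X & diagonalizable (ulsubmx X)].

Definition queer_even_nilpotent n (X : 'M[k]_(n + n)) : Prop :=
  [/\ queer X, has_parity false X & exists m, ulsubmx X ^+ m = 0].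

(* Regular: the centralizer in gl_n has the least possible dimension. *)
Definition queer_even_principal_nilpotent n (X : 'M[k]_(n + n)) : Prop :=
  queer_even_nilpotent X /\
  forall B : 'M[k]_n,
    (\rank 'C(mxvec (ulsubmx X))%MS <= \rank 'C(mxvec B)%MS)%N.

Definition distinguished n (x : 'M[k]_(n + n)) : Prop :=
  forall t, queer_even_semisimple t -> sbracket t x = 0 -> queer_center t.

Definition jordan_decomposition n (y s f : 'M[k]_(n + n)) : Prop :=
  [/\ y = s + f, queer_even_semisimple s, queer_even_nilpotent f
    & sbracket s f = 0].

Definition sl2_triple n (e h f : 'M[k]_(n + n)) : Prop :=
  [/\ sbracket h e = 2%:R *: e,
      sbracket h f = - (2%:R *: f)
    & sbracket e f = h].

End SuperMatrices.

Section KxModules.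
Variable k : fieldType.

(* A finite-dimensional Z/2-graded module over k[x], x odd: the action of x is
   given by its two components, odd -> even and even -> odd. *)
Record kxmod := KxMod {
  kx_dim0 : nat;
  kx_dim1 : nat;
  kx_x10 : 'M[k]_(kx_dim0, kx_dim1);
  kx_x01 : 'M[k]_(kx_dim1, kx_dim0) }.

Definition kxmod_of p q (x : 'M[k]_(p + q)) : kxmod :=
  KxMod (ursubmx x) (dlsubmx x).

Definition kx_sum (W1 W2 : kxmod) : kxmod :=
  KxMod (block_mx (kx_x10 W1) 0 0 (kx_x10 W2))
        (block_mx (kx_x01 W1) 0 0 (kx_x01 W2)).

(* The convention x (Pi w) = - Pi (x w) gives an isomorphic module. *)
Definition kx_Pi (W : kxmod) : kxmod := KxMod (kx_x01 W) (kx_x10 W).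

Definition kx_iso (W W' : kxmod) : Prop :=
  exists (u0 : 'M[k]_(kx_dim0 W', kx_dim0 W))
         (u1 : 'M[k]_(kx_dim1 W', kx_dim1 W))
         (v0 : 'M[k]_(kx_dim0 W, kx_dim0 W'))
         (v1 : 'M[k]_(kx_dim1 W, kx_dim1 W')),
    [/\ u0 *m v0 = 1%:M /\ v0 *m u0 = 1%:M,
        u1 *m v1 = 1%:M /\ v1 *m u1 = 1%:M,
        u0 *m kx_x10 W = kx_x10 W' *m u1
      & u1 *m kx_x01 W = kx_x01 W' *m u0].

Definition kx_zero (W : kxmod) : Prop := kx_dim0 W = 0%N /\ kx_dim1 W = 0%N.

Definition kx_indecomposable (W : kxmod) : Prop :=
  ~ kx_zero W /\
  forall W1 W2, kx_iso W (kx_sum W1 W2) -> kx_zero W1 \/ kx_zero W2.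

End KxModules.

Section Representations.
Variable k : fieldType.

(* The values of [rho] outside q(n) are irrelevant. *)
Definition queer_module n p q
    (rho : 'M[k]_(n + n) -> 'M[k]_(p + q)) : Prop :=
  [/\ forall (a : k) X Y, queer X -> queer Y ->
        rho (a *: X + Y) = a *: rho X + rho Y,
      forall b X, queer X -> has_parity b X -> has_parity b (rho X)
    & forall X Y, queer X -> queer Y ->
        rho (sbracket X Y) = sbracket (rho X) (rho Y)].

(* Value at the matrix g, with entries in a k-algebra S (structure map c), of a
   matrix of polynomials in the n * n entries of a generic matrix. *)
Definition gl_eval (S : comNzRingType) (c : k -> S) n m
    (P : 'M[{mpoly k[n * n]}]_m) (g : 'M[S]_n) : 'M[S]_m :=
  map_mx (mmap c (mxvec g 0)) P.

(* The restriction of rho to q(n)_0 = gl_n is the differential at 1 of an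
   algebraic representation r of GL_n by even automorphisms of k^(p|q).
   A matrix of regular functions on GL_n is a polynomial matrix divided by a
   power of det; the last clause is r(1 + eps A) = 1 + eps rho(A) over
   k[eps] = k[X]/(X^2), multiplied by det(1 + eps A)^d. *)
Definition integrates_to_GL n p q
    (rho : 'M[k]_(n + n) -> 'M[k]_(p + q)) : Prop :=
  exists (d : nat) (P : 'M[{mpoly k[n * n]}]_(p + q)),
    let r (g : 'M[k]_n) := (\det g) ^- d *: gl_eval idfun P g in
    [/\ r 1%:M = 1%:M,
        {in unitmx &, forall g g', r (g *m g') = r g *m r g'},
        {in unitmx, forall g, has_parity false (r g)}
      & forall (A : 'M[k]_n) (i j : 'I_(p + q)),
          let A_eps : 'M[{poly k}]_n := 1%:M + 'X *: map_mx polyC A in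
          let rho_eps : 'M[{poly k}]_(p + q) :=
            1%:M + 'X *: map_mx polyC (rho (block_mx A 0 0 A)) in
          'X^2 %| gl_eval polyC P A_eps i j - (\det A_eps) ^+ d * rho_eps i j].

(* rho makes k^(p|q) an object of Rep(Q(n)). *)
Definition RepQ n p q (rho : 'M[k]_(n + n) -> 'M[k]_(p + q)) : Prop :=
  queer_module rho /\ integrates_to_GL rho.

Definition jordan_block m : 'M[k]_m := \matrix_(i, j) (i.+1 == j)%:R.

(* T is conjugate to the direct sum of r nilpotent Jordan blocks, of positive
   sizes d 0, ..., d (r - 1); the d i are unique up to order. *)
Definition jordan_sizes m (T : 'M[k]_m) r (d : 'I_r -> nat) : Prop :=
  (forall i, (0 < d i)%N) /\
  exists (u : 'M[k]_(\sum_i d i, m)) (v : 'M[k]_(m, \sum_i d i)),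
    [/\ u *m v = 1%:M, v *m u = 1%:M
      & u *m T = mxdiag (fun i => jordan_block (d i)) *m u].

Definition all_jordan_sizes (good : pred nat) m (T : 'M[k]_m) : Prop :=
  exists (r : nat) (d : 'I_r -> nat),
    jordan_sizes T d /\ forall i, good (d i).

Definition neat n (x : 'M[k]_(n + n)) : Prop :=
  forall p q (rho : 'M[k]_(n + n) -> 'M[k]_(p + q)), RepQ rho ->
    all_jordan_sizes odd (rho x).

Definition balanced n (x : 'M[k]_(n + n)) : Prop :=
  forall p q (rho : 'M[k]_(n + n) -> 'M[k]_(p + q)), RepQ rho ->
    all_jordan_sizes (fun m => (m == 1)%N || ~~ odd m) (rho x).

End Representations.

(* Main.v *)
Require Import Defs.
From HB Require Import structures.
From mathcomp Require Import all_boot all_order all_algebra.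
From mathcomp Require Import mpoly.
From mathcomp Require Import ring zify.

Set Implicit Arguments.
Unset Strict Implicit.
Unset Printing Implicit Defensive.

Import GRing.Theory.
Local Open Scope ring_scope.

(* Write x = [[0, B], [B, 0]].  Idempotents commuting with B are scalar when x is
   distinguished, so B = mu + N with N a single nilpotent Jordan block, s = mu^2
   and f = N (2 mu + N).  If mu <> 0 then f is regular, B is a polynomial in f,
   and f^i has weight -2i.

   If mu = 0, then f = N^2 is the lowering operator of an sl2-triple (e, h, f) in
   gl_n, and the Jordan blocks of x on a representation are constrained by the
   weights -i, -(i+1), ... of h on ker f /\ im f^i.  For n odd the triple can be
   chosen with [h, x] = -x; a block of size 2i would then give a vector of ker f
   with weights at most -i outside im f^i, which is impossible.  For n even,
   k^n = k^(n/2) (x) k^2 and x = Q + iota_f, where Q is odd, commutes with the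
   sl2, and the odd operators iota_y satisfy [Q, iota_y] = y: the sl2 acts
   null-homotopically for Q.  The operator K = 2 (e iota_f + f iota_e) + h iota_h
   commutes with h and f, and [x, K] is twice the Casimir element plus a nilpotent
   term; hence [x, K] is invertible on ker x /\ im f^i for i > 0, so that every
   vector there is in x (im f^i), and no block has odd size 2i + 1 > 1. *)

(** * Nilpotent matrices *)

Section MatrixFacts.
Variable k : fieldType.

Lemma intertwineX m n (X : 'M[k]_(m, n)) (A : 'M_n) (B : 'M_m) i :
  X *m A = B *m X -> X *m (A ^+ i) = B ^+ i *m X.
Proof.
move=> AB; elim: i => [|i IHi]; first by rewrite !expr0 mulmx1 mul1mx.
by rewrite !exprS -!mulmxE mulmxA AB -!mulmxA IHi.
Qed.

Lemma block_diagX n1 n2 (A : 'M[k]_n1) (B : 'M_n2) i :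
  block_mx A 0 0 B ^+ i = block_mx (A ^+ i) 0 0 (B ^+ i).
Proof.
elim: i => [|i IHi]; first by rewrite !expr0 -scalar_mx_block.
rewrite exprS IHi -mulmxE mulmx_block !(mulmx0, mul0mx, addr0, add0r).
by rewrite !mulmxE -!exprS.
Qed.

Lemma jordan_blockX d i :
  jordan_block k d ^+ i = \matrix_(a, b) (a + i == b)%N%:R.
Proof.
elim: i => [|i IHi]; first by apply/matrixP => a b; rewrite !mxE addn0 -val_eqE.
rewrite exprSr IHi; apply/matrixP => a b; rewrite !mxE.
have [lt_ai|ge_ai] := ltnP (a + i) d.
  rewrite (bigD1 (Ordinal lt_ai)) //= !mxE eqxx mul1r addnS big1 ?addr0 //.
  move=> c ne; rewrite !mxE; case: eqP => [e|_]; last by rewrite mul0r.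
  by case/eqP: ne; apply: val_inj.
rewrite big1 => [|c _]; last first.
  by rewrite !mxE; case: eqP => [e|_]; [rewrite leqNgt e ltn_ord in ge_ai | rewrite mul0r].
case: eqP => // e.
by have := ltn_ord b; rewrite -e addnS ltnNge (leq_trans ge_ai (leqnSn _)).
Qed.

Lemma jordan_block_nilp d : jordan_block k d ^+ d = 0.
Proof.
rewrite jordan_blockX; apply/matrixP => a b; rewrite !mxE.
by case: eqP => // e; have := ltn_ord b; rewrite -e ltnNge leq_addl.
Qed.

Lemma jordan_blockX_neq0 d i : (i < d)%N -> jordan_block k d ^+ i != 0.
Proof.
move=> lt_id; have d_gt0 : (0 < d)%N by apply: leq_ltn_trans lt_id.
apply/eqP => /matrixP/(_ (Ordinal d_gt0) (Ordinal lt_id)).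
by rewrite jordan_blockX !mxE /= eqxx => /eqP; rewrite oner_eq0.
Qed.

(* If the (a, b) entry of N^d is nonzero, take the rows e_a N^i for U and the
   columns N^(d-j) e_b for Phi: then U Phi is triangular. *)
Lemma nilpotent_chain m (N : 'M[k]_m) d :
  N ^+ d.+1 = 0 -> N ^+ d != 0 ->
  exists (U : 'M_(d.+1, m)) (Phi : 'M_(m, d.+1)),
    [/\ U *m N = jordan_block k d.+1 *m U,
        N *m Phi = Phi *m jordan_block k d.+1
      & U *m Phi \in unitmx].
Proof.
move=> Nd /matrix0Pn[a [b Nab]].
have N0 i : (d < i)%N -> N ^+ i = 0.
  by move=> lt_di; rewrite -(subnK lt_di) exprD Nd mulr0.
pose U : 'M_(d.+1, m) := \matrix_(i, j) (N ^+ i) a j.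
pose Phi : 'M_(m, d.+1) := \matrix_(i, j) (N ^+ (d - j)) i b.
exists U, Phi; split.
- apply/matrixP => i j; rewrite !mxE.
  have -> : \sum_l U i l * N l j = (N ^+ i.+1) a j.
    by rewrite exprSr !mxE; apply: eq_bigr => l _; rewrite !mxE.
  have [lt_id|] := ltnP i.+1 d.+1.
    rewrite (bigD1 (Ordinal lt_id)) //= !mxE eqxx mul1r big1 ?addr0 // => l ne.
    rewrite !mxE; case: eqP => [e|_]; last by rewrite mul0r.
    by case/eqP: ne; apply: val_inj.
  move=> ge_id; rewrite N0 // mxE big1 // => l _; rewrite !mxE.
  by case: eqP => [e|_]; [rewrite leqNgt e ltn_ord in ge_id | rewrite mul0r].
- apply/matrixP => i j; rewrite !mxE.
  have -> : \sum_l N i l * Phi l j = (N ^+ (d - j).+1) i b.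
    by rewrite exprS !mxE; apply: eq_bigr => l _; rewrite !mxE.
  case: j => [[|j] lt_jd] /=.
    by rewrite subn0 Nd mxE big1 // => l _; rewrite !mxE mulr0.
  rewrite (bigD1 (Ordinal (ltnW lt_jd))) //= !mxE eqxx mulr1 subnSK //.
  rewrite big1 ?addr0 // => l ne; rewrite !mxE /= eqSS.
  case: eqP => [e|_]; last by rewrite mulr0.
  by case/eqP: ne; apply: val_inj.
have UPhi i j : (U *m Phi) i j = (N ^+ (i + (d - j))) a b.
  by rewrite exprD !mxE; apply: eq_bigr => l _; rewrite !mxE.
rewrite -unitmx_tr unitmxE det_trig => [|]; last first.
  apply/is_trig_mxP => i j lt_ij; rewrite mxE UPhi N0 ?mxE //.
  by rewrite addnBA ?leq_ord // ltn_subRL ltn_add2r.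
rewrite unitfE prodf_seq_neq0; apply/allP => i _ /=.
by rewrite mxE UPhi subnKC ?leq_ord.
Qed.

(* P is the projection onto the span of the rows of U along the kernel of Phi. *)
Lemma chain_proj_comm m d (N : 'M[k]_m) (U : 'M_(d, m)) (Phi : 'M_(m, d)) J :
  U *m N = J *m U -> N *m Phi = Phi *m J -> U *m Phi \in unitmx ->
  let P := Phi *m invmx (U *m Phi) *m U in P *m N = N *m P.
Proof.
move=> UN NP unitG; set G := U *m Phi => P.
have GJ : G *m J = J *m G by rewrite /G -mulmxA -NP !mulmxA UN.
have JG : invmx G *m J = J *m invmx G.
  by apply: (can_inj (mulKmx unitG)); rewrite mulKVmx // mulmxA GJ mulmxK.
by rewrite /P -mulmxA UN !mulmxA -[_ *m _ *m J]mulmxA JG NP !mulmxA.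
Qed.

Lemma mulmx1_dim a b (u : 'M[k]_(a, b)) (v : 'M_(b, a)) :
  u *m v = 1%:M -> v *m u = 1%:M -> a = b.
Proof.
move=> uv vu; apply/eqP; rewrite eqn_leq; apply/andP; split.
  by rewrite -[X in (X <= _)%N](mxrank1 k) -uv (leq_trans (mxrankM_maxl _ _)) ?rank_leq_col.
by rewrite -[X in (X <= _)%N](mxrank1 k) -vu (leq_trans (mxrankM_maxl _ _)) ?rank_leq_col.
Qed.

(** With [d + 1] the nilpotency index, the row span of [U] and the left kernel of [Phi] are both
    stable under [N], and they are complementary because [U Phi] is invertible. *)
Lemma nilpotent_split m (N : 'M[k]_m) : (0 < m)%N -> (exists i, N ^+ i = 0) ->
  exists d m' (T : 'M_m') (u : 'M_(d.+1 + m', m)) (v : 'M_(m, d.+1 + m')),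
    [/\ u *m v = 1%:M, v *m u = 1%:M
      & u *m N = block_mx (jordan_block k d.+1) 0 0 T *m u].
Proof.
move=> m_gt0 nilN.
have [|[|d] /eqP Nd min_d] := @ex_minnP (fun i => N ^+ i == 0).
- by case: nilN => i /eqP; exists i.
- by have /matrixP/(_ (Ordinal m_gt0) (Ordinal m_gt0)) := Nd;
    rewrite expr0 !mxE eqxx => /eqP; rewrite oner_eq0.
have Nd' : N ^+ d != 0 by apply/negP => /min_d; rewrite ltnn.
have [U [Phi [UN NPhi unitG]]] := nilpotent_chain Nd Nd'.
set G := U *m Phi in unitG; pose R := row_base (kermx Phi).
have RPhi : R *m Phi = 0.
  by apply/sub_kermxP; rewrite eq_row_base.
have [T RN] : exists T, R *m N = T *m R.
  apply/submxP; rewrite eq_row_base; apply/sub_kermxP.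
  by rewrite -mulmxA NPhi mulmxA RPhi mul0mx.
(* [V1] and [V2] are the two blocks of the inverse of [col_mx U R]; the rows of [1 - V1 U] lie in
   the left kernel of [Phi]. *)
pose V1 := Phi *m invmx G; pose R' := pinvmx R.
pose V2 := (1%:M - V1 *m U) *m R'.
have RR' : R *m R' = 1%:M by rewrite mulmxVp ?row_base_free.
have UV1 : U *m V1 = 1%:M by rewrite mulmxA mulmxV.
have RV1 : R *m V1 = 0 by rewrite mulmxA RPhi mul0mx.
have UV2 : U *m V2 = 0.
  by rewrite mulmxA mulmxBr mulmx1 [U *m (_ *m _)]mulmxA UV1 mul1mx subrr mul0mx.
have RV2 : R *m V2 = 1%:M.
  by rewrite mulmxA mulmxBr mulmx1 [R *m (_ *m _)]mulmxA RV1 mul0mx subr0.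
have V2R : V2 *m R = 1%:M - V1 *m U.
  rewrite mulmxKpV // eq_row_base; apply/sub_kermxP.
  by rewrite mulmxBl mul1mx -!mulmxA mulVmx // mulmx1 subrr.
exists d, (\rank (kermx Phi)), T, (col_mx U R), (row_mx V1 V2); split.
- by rewrite mul_col_row UV1 UV2 RV1 RV2 -scalar_mx_block.
- by rewrite mul_row_col V2R addrC subrK.
by rewrite mul_col_mx mul_block_col !mul0mx addr0 add0r UN RN.
Qed.

(* T has no Jordan block of size d: the last basis vector v of such a block has
   T^d v = 0, but T^(d-1) v is not in the image of T^d. *)
Definition no_block m (T : 'M[k]_m) d :=
  forall v : 'cV_m, T ^+ d *m v = 0 -> exists w, T ^+ d.-1 *m v = T ^+ d *m w.

Lemma similar_nilp m n (T : 'M[k]_m) (T' : 'M_n) (u : 'M_(n, m)) (v : 'M_(m, n)) i :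
  v *m u = 1%:M -> u *m T = T' *m u -> T' ^+ i = 0 -> T ^+ i = 0.
Proof.
by move=> vu uT T'i; rewrite -[LHS]mul1mx -vu -mulmxA (intertwineX _ uT) T'i mul0mx mulmx0.
Qed.

Lemma no_block_similar m n (T : 'M[k]_m) (T' : 'M_n)
    (u : 'M_(n, m)) (v : 'M_(m, n)) d :
  u *m v = 1%:M -> v *m u = 1%:M -> u *m T = T' *m u ->
  no_block T d -> no_block T' d.
Proof.
move=> uv vu uT noT w Tw.
have vT i : v *m T' ^+ i = T ^+ i *m v.
  by rewrite -[LHS]mulmx1 -uv mulmxA -[_ *m _ *m u]mulmxA -(intertwineX _ uT) !mulmxA vu mul1mx.
have [|y Ty] := noT (v *m w); first by rewrite mulmxA -vT -mulmxA Tw mulmx0.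
exists (u *m y); rewrite mulmxA -(intertwineX _ uT) -mulmxA -Ty.
by rewrite !mulmxA (intertwineX _ uT) -[_ *m u *m v]mulmxA uv mulmx1.
Qed.

Lemma no_block_diag n1 n2 (A : 'M[k]_n1) (B : 'M_n2) d :
  no_block (block_mx A 0 0 B) d -> no_block A d /\ no_block B d.
Proof.
move=> noAB; split=> v Av.
  have [|w] := noAB (col_mx v 0).
    by rewrite block_diagX mul_block_col Av !(mulmx0, mul0mx, addr0) col_mx0.
  rewrite -[w]vsubmxK !block_diagX !mul_block_col !(mulmx0, mul0mx, addr0, add0r).
  by case/eq_col_mx => ? _; exists (usubmx w).
have [|w] := noAB (col_mx 0 v).
  by rewrite block_diagX mul_block_col Av !(mulmx0, mul0mx, addr0) col_mx0.
rewrite -[w]vsubmxK !block_diagX !mul_block_col !(mulmx0, mul0mx, addr0, add0r).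
by case/eq_col_mx => _ ?; exists (dsubmx w).
Qed.

(** The power [d + 1] of the block vanishes, so [no_block] would force its power [d] to vanish
    too. *)
Lemma has_jordan_block d : ~ no_block (jordan_block k d.+1) d.+1.
Proof.
rewrite /no_block jordan_block_nilp /= => no.
have /eqP[] := @jordan_blockX_neq0 d.+1 d (ltnSn d).
apply/matrixP => i j; have [|w] := no (delta_mx j 0); first exact: mul0mx.
by rewrite mul0mx -colE => /matrixP/(_ i 0); rewrite !mxE.
Qed.

(** Absorbs the cast of sizes that [mxdiag_recl] creates when a block is split off in front. *)
Lemma similar_cast n1 n2 m (e : n1 = n2) (J : 'M[k]_n1) (T : 'M_m)
    (u : 'M_(n1, m)) (v : 'M_(m, n1)) :
  u *m v = 1%:M -> v *m u = 1%:M -> u *m T = J *m u ->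
  exists (u' : 'M_(n2, m)) (v' : 'M_(m, n2)),
    [/\ u' *m v' = 1%:M, v' *m u' = 1%:M & u' *m T = castmx (e, e) J *m u'].
Proof. by case: n2 / e => *; exists u, v; rewrite castmx_id. Qed.

(** Induction on the size of [T]: one Jordan block splits off, and [no_block] passes to both
    summands. It fails on the block at the block's own size, so that size is good. *)
Lemma nilpotent_jordan_sizes (good : pred nat) m (T : 'M[k]_m) :
  (exists i, T ^+ i = 0) ->
  (forall d, (0 < d)%N -> ~~ good d -> no_block T d) ->
  all_jordan_sizes good T.
Proof.
(* The sizes are collected in a list, to which the induction can add the new block. *)
suff: (exists i, T ^+ i = 0) ->
    (forall d, (0 < d)%N -> ~~ good d -> no_block T d) ->
    exists2 l : seq nat, all good l
      & jordan_sizes T (fun i : 'I_(size l) => nth 0%N l i).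
  move=> H nilT noT; have [l good_l lT] := H nilT noT.
  exists (size l), (nth 0%N l \o val); split=> [|i]; first exact: lT.
  exact: (all_nthP 0%N good_l) (ltn_ord i).
have [c] := ubnP m; elim: c m T => // c IHc m T lt_mc nilT noT.
have [m0|m_gt0] := posnP m.
  move: T nilT noT; rewrite {}m0 => T _ _; exists [::] => //; split; first by case.
  exists 0, 0; split; last by rewrite [LHS]thinmx0 [RHS]thinmx0.
    by apply/matrixP => -[a lt_a]; exfalso; rewrite /= big_ord0 in lt_a.
  by rewrite [LHS]thinmx0 [RHS]thinmx0.
have [d [m' [T' [u [v [uv vu uT]]]]]] := nilpotent_split m_gt0 nilT.
have no_blocks e : (0 < e)%N -> ~~ good e ->
    no_block (jordan_block k d.+1) e /\ no_block T' e.
  by move=> e_gt0 /(noT _ e_gt0)/(no_block_similar uv vu uT)/no_block_diag.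
have good_d : good d.+1.
  by apply/negPn/negP => /no_blocks[] // /has_jordan_block.
have m'E : (d.+1 + m' = m)%N := mulmx1_dim uv vu.
have nilT' : exists i, T' ^+ i = 0.
  have [i Ti] := nilT; exists i.
  have [|_] := @eq_block_mx _ _ _ _ _ (jordan_block k d.+1 ^+ i) 0 0 (T' ^+ i) 0 0 0 0; last by [].
  rewrite -block_diagX block_mx0 -[LHS]mulmx1 -uv mulmxA -(intertwineX _ uT) Ti.
  by rewrite mulmx0 mul0mx.
have [||l good_l [l_gt0 [u' [v' [uv' vu' uT']]]]] := IHc m' T' _ nilT'.
- by rewrite -ltnS (leq_trans _ lt_mc) // ltnS -m'E addSn ltnS leq_addl.
- by move=> e e_gt0 /(no_blocks _ e_gt0)[].
exists (d.+1 :: l); first by rewrite /= good_d.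
split; first by case=> [[|i] lt_i] //=; apply: (l_gt0 (Ordinal (lt_i : (i < size l)%N))).
rewrite mxdiag_recl.
apply: similar_cast (block_mx 1%:M 0 0 u' *m u) (v *m block_mx 1%:M 0 0 v') _ _ _ => /=.
- rewrite mulmxA -[_ *m _ *m v]mulmxA uv mulmx1 mulmx_block.
  by rewrite !(mulmx0, mul0mx, addr0, add0r) uv' mulmx1 -scalar_mx_block.
- rewrite mulmxA -[_ *m _ *m block_mx _ _ _ u']mulmxA mulmx_block.
  by rewrite !(mulmx0, mul0mx, addr0, add0r) vu' mulmx1 -scalar_mx_block mulmx1.
rewrite -mulmxA uT !mulmxA !mulmx_block !(mulmx0, mul0mx, addr0, add0r) mulmx1 mul1mx.
by rewrite uT'.
Qed.

End MatrixFacts.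

(** * Lowest weight vectors of sl2-modules *)

Section Weights.
Variable k : fieldType.
Hypothesis char0 : [pchar k] =i pred0.

Lemma pchar0_natr_eq0 n : (n%:R == 0 :> k) = (n == 0%N).
Proof. by move: n; apply/(pcharf0P k). Qed.

Lemma pchar0_natr_inj : injective (fun n => n%:R : k).
Proof.
move=> i j /eqP; wlog le_ij : i j / (i <= j)%N => [W eq_ij|].
  by case: (leqP i j) => [|/ltnW] le_ij; [|apply/esym]; apply: W; rewrite // eq_sym.
rewrite eq_sym -subr_eq0 -natrB // pchar0_natr_eq0 subn_eq0 => le_ji.
by apply/eqP; rewrite eqn_leq le_ij.
Qed.

Lemma mulr_exp_commutator m (h g : 'M[k]_m) c i :
  h * g = g * h + c *: g -> h * g ^+ i = g ^+ i * h + (i%:R * c) *: g ^+ i.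
Proof.
move=> hg; elim: i => [|i IHi]; first by rewrite expr0 mulr1 mul1r mul0r scale0r addr0.
rewrite exprSr mulrA IHi mulrDl -mulrA hg mulrDr mulrA -addrA; congr (_ + _).
by rewrite -!mulmxE -scalemxAl -scalemxAr -scalerDl -natr1 mulrDl mul1r addrC.
Qed.

(* Otherwise the powers g^i would be eigenvectors of ad h for infinitely many
   eigenvalues i c. *)
Lemma ad_eigenvector_nilp m (h g : 'M[k]_m) (c : k) :
  c != 0 -> h * g = g * h + c *: g -> exists i, g ^+ i = 0.
Proof.
move=> c_neq0 hg; pose L := lin_mx (mulmx h \- mulmxr h).
have nz : (0 < size (char_poly L))%N by rewrite size_char_poly.
(* One value more than the degree of the characteristic polynomial. *)
pose rs := [seq i%:R * c | i <- iota 0 (size (char_poly L))].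
have [/hasP[i _ /eqP gi]|/hasPn nil] :=
  boolP (has (fun i => g ^+ i == 0) (iota 0 (size (char_poly L)))).
  by exists i.
suff: (size rs < size (char_poly L))%N by rewrite size_map size_iota ltnn.
apply: max_poly_roots; first by rewrite -size_poly_gt0.
  apply/allP => _ /mapP[i i_in ->]; rewrite -eigenvalue_root_char.
  apply/eigenvalueP; exists (mxvec (g ^+ i)); last by rewrite mxvec_eq0 nil.
  rewrite mul_vec_lin /= -linearZ /=; congr mxvec.
  by rewrite !mulmxE (mulr_exp_commutator _ hg) addrAC subrr add0r.
rewrite map_inj_uniq ?iota_uniq // => i j.
by move/(mulIf c_neq0)/pchar0_natr_inj.
Qed.
End Weights.

Section Sl2.
Variable k : closedFieldType.
Hypothesis char0 : [pchar k] =i pred0.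
Variables (m : nat).
Implicit Types (A H : 'M[k]_m.+1) (p : {poly k}).

Lemma horner_mx_intertwine H H' A p :
  A * H = H' * A -> A * horner_mx H p = horner_mx H' p * A.
Proof.
move=> AH; elim/poly_ind: p => [|p c IHp]; first by rewrite !rmorph0 mulr0 mul0r.
rewrite !rmorphD !rmorphM /= !horner_mx_X !horner_mx_C mulrDr mulrDl mulrA IHp.
by rewrite -!mulrA AH -!mulmxE scalar_mxC.
Qed.

(* Kills the vectors whose weights are among -i, -(i+1), ..., -(i+a-1). *)
Definition wpoly i a : {poly k} := \prod_(r < a) ('X + (i + r)%:R).

Lemma horner_wpoly_shift H i a :
  horner_mx (H + 1) (wpoly i a) = horner_mx H (wpoly i.+1 a).
Proof.
rewrite !rmorph_prod; apply: eq_bigr => r _.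
by rewrite !rmorphD /= !horner_mx_X !rmorph_nat addSn -addrA -natrD nat1r.
Qed.

Lemma horner_Xaddn (x : k) n : ('X + n%:R).[x] = x + n%:R.
Proof. by rewrite hornerD hornerX -polyC_natr hornerC. Qed.

(** The roots are -i, -(i+1), ... on one side and 0, ..., -(i-1) on the other; characteristic 0
    keeps them apart. *)
Lemma coprimep_wpoly i a : coprimep (wpoly i a) (wpoly 0 i).
Proof.
apply/Pdiv.ClosedField.coprimepP => x; rewrite /root /wpoly !horner_prod.
rewrite prodf_seq_eq0 => /hasP[r _ /=]; rewrite horner_Xaddn addr_eq0 => /eqP ->.
rewrite prodf_seq_neq0; apply/allP => s _ /=; rewrite horner_Xaddn add0n addrC subr_eq0.
apply/negP => /eqP/(pchar0_natr_inj char0) si.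
by have := ltn_ord s; rewrite si ltnNge leq_addr.
Qed.

(** [X (X - 2)] is twice the Casimir on vectors killed by [F], as a polynomial in the weight. Its
    roots 0 and 2 are not negative integers. *)
Lemma coprimep_wpoly_casimir i a : coprimep (wpoly i.+1 a) ('X * ('X - 2%:R)).
Proof.
apply/Pdiv.ClosedField.coprimepP => x; rewrite /root /wpoly !horner_prod.
rewrite prodf_seq_eq0 => /hasP[r _ /=]; rewrite horner_Xaddn addr_eq0 => /eqP ->.
rewrite hornerM hornerX hornerD hornerN hornerX -polyC_natr hornerC.
rewrite mulf_neq0 ?oppr_eq0 ?addSn ?pchar0_natr_eq0 //.
by rewrite -opprD oppr_eq0 -natrD pchar0_natr_eq0.
Qed.

Section Triple.
Variables E H F : 'M[k]_m.+1.
Hypothesis HE : H * E = E * H + E *+ 2.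
Hypothesis HF : H * F = F * H - F *+ 2.
Hypothesis EF : E * F = F * E + H.

Let FH : F * H = (H + 2%:R) * F.
Proof. by rewrite mulrDl HF mulr_natl subrK. Qed.

Lemma ker_lowering_horner v p : F * v = 0 -> F * (horner_mx H p * v) = 0.
Proof. by move=> Fv; rewrite mulrA (horner_mx_intertwine _ FH) -mulrA Fv mulr0. Qed.

Let FHn b : F * (H + b%:R) = (H + b.+2%:R) * F.
Proof. by rewrite mulrDr FH commr_nat -mulrDl -addrA -natrD add2n. Qed.

Let FbE b : F ^+ b.+1 * E = E * F ^+ b.+1 - ((H + b%:R) * F ^+ b) *+ b.+1.
Proof.
have FE : F * E = E * F - H by rewrite EF addrK.
elim: b => [|b IHb]; first by rewrite !expr1 expr0 mulr1 addr0.
rewrite [F ^+ b.+2]exprS -mulrA IHb mulrBr [F * (E * _)]mulrA FE mulrBl -[E * F * _]mulrA.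
rewrite -addrA -opprD; congr (_ - _); rewrite mulrnAr [F * (_ * _)]mulrA FHn -mulrA -exprS.
by rewrite !mulrDl !mulr_natl !mulrnDl -!mulrnA addrA -mulrS mulnC mul1r -mulrnDr.
Qed.

(** Induction on [a] through [FbE]: one more [E] contributes the factor [-(a + i + 1) (H + a + i)].
    The other term dies because, by induction, [F^(a+i) E^a v] is a polynomial in [H] applied to
    [F^i v], hence lies in the kernel of [F]. *)
Lemma lowering_raising i a v : F ^+ i.+1 * v = 0 ->
  exists2 c, c != 0
    & F ^+ (a + i) * (E ^+ a * v) = c *: (horner_mx H (wpoly i a) * (F ^+ i * v)).
Proof.
move=> Fv; elim: a => [|a [c c_neq0 IHa]].
  by exists 1; rewrite ?oner_eq0 // /wpoly big_ord0 rmorph1 scale1r !mul1r.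
exists (- ((a + i).+1%:R * c)).
  by rewrite oppr_eq0 mulf_neq0 // pchar0_natr_eq0.
rewrite addSn [E ^+ _]exprS -[E * _ * v]mulrA [LHS]mulrA FbE mulrBl -[E * _ * _]mulrA.
have -> : F ^+ (a + i).+1 * (E ^+ a * v) = 0.
  rewrite exprS -mulrA IHa -mulmxE -scalemxAr mulmxE ker_lowering_horner ?scaler0 //.
  by rewrite mulrA -exprS.
rewrite mulr0 add0r [_ *+ _ * (_ * v)]mulrnAl -mulrA IHa -scaler_nat.
rewrite -mulmxE -scalemxAr mulmxE scalerA -scaleNr.
congr (_ *: _); rewrite mulrA.
have -> : wpoly i a.+1 = ('X + (a + i)%:R) * wpoly i a.
  by rewrite /wpoly big_ord_recr mulrC /= addnC.
by rewrite rmorphM /= [horner_mx H (_ + _)]rmorphD /= horner_mx_X rmorph_nat mulrA.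
Qed.

Lemma raising_nilp : exists a, E ^+ a = 0.
Proof.
apply: (ad_eigenvector_nilp char0 (h := H) (c := 2%:R)); first by rewrite pchar0_natr_eq0.
by rewrite HE scaler_nat.
Qed.

Lemma lowering_nilp : exists a, F ^+ a = 0.
Proof.
apply: (ad_eigenvector_nilp char0 (h := H) (c := - 2%:R)).
  by rewrite oppr_eq0 pchar0_natr_eq0.
by rewrite HF scaleNr scaler_nat.
Qed.

(** Once [E^a = 0], the left side of [lowering_raising] vanishes; this [a] serves all [i] and
    [v]. *)
Lemma lowest_weights : exists a, forall i v,
  F ^+ i.+1 * v = 0 -> horner_mx H (wpoly i a) * (F ^+ i * v) = 0.
Proof.
have [a Ea] := raising_nilp; exists a => i v /(lowering_raising a)[c c_neq0].
rewrite Ea mul0r mulr0 => /esym/eqP; rewrite scaler_eq0 (negPf c_neq0).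
by move/eqP.
Qed.

(** On the kernel of [F], [F^i E^i] is a nonzero multiple of [wpoly 0 i] evaluated at [H]. This is
    invertible on [u] by coprimality, and a Bezout relation provides the preimage. *)
Lemma lowest_weight_image i a u : F * u = 0 -> horner_mx H (wpoly i a) * u = 0 ->
  exists w, u = F ^+ i * w.
Proof.
move=> Fu Hu; have /Bezout_eq1_coprimepP[[p q] /= pq1] := coprimep_wpoly i a.
have [|c c_neq0] := @lowering_raising 0 i (horner_mx H q * u).
  by rewrite expr1 ker_lowering_horner.
rewrite addn0 expr0 mul1r => FEq.
exists (c^-1 *: (E ^+ i * (horner_mx H q * u))).
rewrite -mulmxE -scalemxAr mulmxE FEq scalerA mulVf // scale1r mulrA.
rewrite -rmorphM /= [_ * q]mulrC -{1}[u]mul1r -(rmorph1 (horner_mx H)) -pq1.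
by rewrite rmorphD /= mulrDl [horner_mx H (p * _)]rmorphM /= -mulrA Hu mulr0 add0r.
Qed.

Lemma col_delta_mx (v : 'cV[k]_m.+1) :
  v = v *m (delta_mx 0 0 : 'rV_m.+1) *m (delta_mx 0 0 : 'cV_m.+1).
Proof.
by rewrite -mulmxA mul_delta_mx; apply/matrixP => i j;
  rewrite !mxE big_ord1 !mxE !ord1 mulr1.
Qed.

(** Square matrices replace column vectors, so that all computations take place in one matrix
    ring. *)
Lemma no_block_square (T : 'M[k]_m.+1) d :
  (forall v : 'M_m.+1, T ^+ d * v = 0 -> exists w, T ^+ d.-1 * v = T ^+ d * w) ->
  no_block T d.
Proof.
move=> noT v Tv.
have vE := col_delta_mx v.
have [|w Tw] := noT (v *m delta_mx 0 0); first by rewrite -mulmxE mulmxA Tv mul0mx.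
exists (w *m delta_mx 0 0); rewrite -!mulmxE in Tw.
by rewrite {1}vE [LHS]mulmxA Tw mulmxA.
Qed.

(* X shifts weights by 1, so X F^j v, a lowest weight vector of weight at most
   -(j+1), lies in the image of F^(j+1). *)
Lemma weighted_sqrt_no_even_block X d :
  X * X = F -> H * X = X * H - X -> (0 < d)%N -> ~~ odd d -> no_block X d.
Proof.
move=> XX HX d_gt0 even_d; have [j dE] : exists j, d = (2 * j.+1)%N.
  by exists (d./2.-1); rewrite prednK ?mul2n ?even_halfK // half_gt0; case: d d_gt0 even_d => [|[]].
apply: no_block_square => v; rewrite {}dE exprM expr2 XX => Fv.
have -> : X ^+ (2 * j.+1).-1 = X * F ^+ j by rewrite mulnS /= exprS exprM expr2 XX.
have XF : X * F = F * X by rewrite -XX mulrA.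
have XH : X * H = (H + 1) * X by rewrite mulrDl mul1r HX subrK.
have [a low_a] := lowest_weights.
have [||w ->] := @lowest_weight_image j.+1 a (X * F ^+ j * v); last by exists w.
  by rewrite !mulrA -XF -[X * F * _]mulrA -exprS -mulrA Fv mulr0.
rewrite -[X * _ * v]mulrA -horner_wpoly_shift [LHS]mulrA -(horner_mx_intertwine _ XH) -mulrA low_a //.
by rewrite mulr0.
Qed.

(** [D] maps the column space of [S] to itself injectively, hence onto for reasons of dimension. The
    transposes translate this into row spaces. *)
Lemma stable_injective_onto (D S C : 'M[k]_m.+1) :
  D * S = S * C -> (forall y, D * (S * y) = 0 -> S * y = 0) ->
  exists C', S = D * S * C'.
Proof.
move=> DS injD; have /submxP[C' SE] : (S^T <= S^T *m D^T)%MS.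
  have sub : (S^T *m D^T <= S^T)%MS.
    by rewrite -trmx_mul mulmxE DS -mulmxE trmx_mul submxMl.
  suff /eqP/mxrank_injP rk : (S^T :&: kermx D^T = 0)%MS.
    by rewrite -(geq_leqif (mxrank_leqif_sup sub)) rk.
  apply/eqP/rowV0P => u; rewrite sub_capmx => /andP[/submxP[y ->] /sub_kermxP yS].
  have /injD Sy : D * (S * (y^T *m delta_mx 0 0)) = 0.
    have DSy : D *m S *m y^T = 0 by apply: trmx_inj; rewrite !trmx_mul trmxK mulmxA yS trmx0.
    by rewrite -!mulmxE !mulmxA DSy mul0mx.
  apply: trmx_inj; rewrite trmx_mul trmxK trmx0 [LHS]col_delta_mx.
  by rewrite -mulmxE in Sy; rewrite -[S *m _ *m _]mulmxA Sy mul0mx.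
by exists C'^T; rewrite -[LHS]trmxK SE !trmx_mul !trmxK.
Qed.

(** * Null-homotopic sl2-actions and the Casimir element *)

Section NullHomotopic.

(* A null homotopy of the sl2-action: Q commutes with E, H, F and anticommutes
   with Ie, Ih, If to E, H, F. *)
Variables Q Ie Ih If : 'M[k]_m.+1.
Hypothesis QE : Q * E = E * Q.
Hypothesis QH : Q * H = H * Q.
Hypothesis QF : Q * F = F * Q.
Hypothesis QIe : Q * Ie + Ie * Q = E.
Hypothesis QIh : Q * Ih + Ih * Q = H.
Hypothesis QIf : Q * If + If * Q = F.
Hypothesis HIe : H * Ie = Ie * H + Ie *+ 2.
Hypothesis HIh : H * Ih = Ih * H.
Hypothesis HIf : H * If = If * H - If *+ 2.
Hypothesis FIe : F * Ie = Ie * F - Ih.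
Hypothesis FIh : F * Ih = Ih * F + If *+ 2.
Hypothesis FIf : F * If = If * F.

Section CasimirHomotopy.
Variables X K D N : 'M[k]_m.+1.
Hypothesis XE : X = Q + If.
Hypothesis XX : X * X = F.
(** In each monomial of [2 (E F + F E) + H H], the right factor is replaced by its homotopy, so that
    [Q K + K Q] is this element, twice the Casimir. *)
Hypothesis KE : K = (E * If + F * Ie) *+ 2 + H * Ih.
Hypothesis DE : D = X * K + K * X.
Hypothesis NE : N = If * K + K * If.

Let HK : H * K = K * H.
Proof.
have h1 : H * (E * If) = E * If * H.
  by rewrite mulrA HE mulrDl -mulrA HIf mulrBr mulrA mulrnAr mulrnAl subrK.
have h2 : H * (F * Ie) = F * Ie * H.
  by rewrite mulrA HF mulrBl -[F * H * _]mulrA HIe mulrDr mulrA mulrnAr mulrnAl addrK.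
have h3 : H * (H * Ih) = H * Ih * H by rewrite -mulrA -HIh.
by rewrite KE mulrDr mulrDl mulrnAr mulrnAl mulrDr mulrDl h1 h2 h3.
Qed.

Let FK : F * K = K * F.
Proof.
have f1 : F * (E * If) = E * If * F - H * If.
  by rewrite mulrA -[F * E](addrK H) -EF mulrBl -[E * F * _]mulrA FIf mulrA.
have f2 : F * (F * Ie) = F * Ie * F - F * Ih by rewrite FIe mulrBr mulrA -FIe.
have f3 : F * (H * Ih) = H * Ih * F + (H * If + F * Ih) *+ 2.
  rewrite mulrA -[F * H](subrK (F *+ 2)) -HF [_ * Ih]mulrDl -[H * F * _]mulrA [in LHS]FIh mulrDr mulrA.
  by rewrite mulrnAr mulrnAl -addrA -mulrnDl.
rewrite KE mulrDr mulrDl mulrnAr mulrnAl mulrDr mulrDl f1 f2 f3.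
by rewrite [_ - _ + (_ - _)]addrACA -opprD mulrnBl [_ + (_ *+ 2)]addrC addrA subrK.
Qed.

Let FX : F * X = X * F.
Proof. by rewrite -XX mulrA. Qed.

Let FD : F * D = D * F.
Proof. by rewrite DE mulrDr mulrDl !mulrA FX FK -!mulrA FK FX. Qed.

Let XD : X * D = D * X.
Proof. by rewrite DE mulrDr mulrDl !mulrA XX -[K * X * X]mulrA XX FK addrC. Qed.

(** The summand [Q] of [X] yields twice the Casimir, the summand [If] yields [N]. *)
Let D_casimir : D = (E * F + F * E) *+ 2 + H * H + N.
Proof.
have anti A B C : Q * A = A * Q -> Q * B + B * Q = C -> Q * (A * B) + A * B * Q = A * C.
  by move=> QA <-; rewrite mulrDr !mulrA QA.
rewrite DE NE XE mulrDl mulrDr addrACA; congr (_ + _).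
have QY : Q * (E * If + F * Ie) + (E * If + F * Ie) * Q = E * F + F * E.
  by rewrite mulrDr mulrDl addrACA (anti _ _ _ QE QIf) (anti _ _ _ QF QIe).
by rewrite KE mulrDr mulrDl addrACA (anti _ _ _ QH QIh) mulrnAr mulrnAl -mulrnDl QY.
Qed.

Let HN : H * N = N * H - N *+ 2.
Proof.
have n1 : H * (If * K) = If * K * H - If * K *+ 2.
  by rewrite mulrA HIf mulrBl -[If * H * _]mulrA HK mulrA mulrnAl.
have n2 : H * (K * If) = K * If * H - K * If *+ 2.
  by rewrite mulrA HK -[K * H * _]mulrA HIf mulrBr mulrA mulrnAr.
by rewrite NE mulrDr n1 n2 mulrDl mulrnDl addrACA -opprD.
Qed.

(** On such a vector [u], the Casimir part of [D] acts as [H (H - 2)], which is invertible on the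
    weights allowed by [lowest_weights]. Hence [D u = 0] gives [u = G u] with [G] of weight -2, and
    such a [G] is nilpotent. *)
Lemma casimir_homotopy_inj j v :
  X * (F ^+ j.+1 * v) = 0 -> D * (F ^+ j.+1 * v) = 0 -> F ^+ j.+1 * v = 0.
Proof.
set u := F ^+ _ * v => Xu Du; have Fu : F * u = 0 by rewrite -XX -mulrA Xu mulr0.
have [a low_a] := lowest_weights.
have /low_a : F ^+ j.+2 * v = 0 by rewrite exprS -mulrA.
rewrite -/u => Hu; set c : {poly k} := 'X * ('X - 2%:R).
have EFu : E * F * u = 0 by rewrite -mulrA Fu mulr0.
have FEu : F * E * u = - (H * u) by rewrite -[F * E](addrK H) -EF mulrBl EFu sub0r.
have cE : horner_mx H c * u = ((E * F + F * E) *+ 2 + H * H) * u.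
  rewrite [horner_mx _ _]rmorphM /= [horner_mx H ('X - _)]rmorphB /= horner_mx_X rmorph_nat -mulrA.
  rewrite mulrBl mulr_natl mulrBr mulrnAr [RHS]mulrDl mulrnAl mulrDl EFu add0r FEu.
  by rewrite mulNrn addrC mulrA.
have cu : horner_mx H c * u = - (N * u).
  by apply/eqP; rewrite -addr_eq0 cE -mulrDl -D_casimir Du.
have /Bezout_eq1_coprimepP[[p q] /= pq1] := coprimep_wpoly_casimir j a.
pose G := - (horner_mx H q * N).
have uG : u = G * u.
  rewrite -{1}[u]mul1r -(rmorph1 (horner_mx H)) -pq1 rmorphD mulrDl /=.
  rewrite [horner_mx H (p * _)]rmorphM [horner_mx H (q * _)]rmorphM /=.
  by rewrite -mulrA Hu mulr0 add0r -mulrA cu mulrN mulrA -mulNr.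
have [||r Gr] := @ad_eigenvector_nilp k char0 _ H G (- 2%:R).
- by rewrite oppr_eq0 pchar0_natr_eq0.
- have Hq : H * horner_mx H q = horner_mx H q * H by apply: horner_mx_intertwine.
  rewrite /G scaleNr scaler_nat mulrN mulrA Hq -mulrA HN mulrBr mulrnAr mulrA.
  by rewrite opprB mulNr mulNrn opprK addrC.
have : u = G ^+ r * u by elim: (r) => [|i IHi]; rewrite ?mul1r // exprSr -mulrA -uG.
by rewrite Gr mul0r.
Qed.

(** With [d = 2 (j + 1) + 1], the vector in question lies in the kernel of [X] inside the image of
    [F^(j+1)]. [D] is bijective on this space and equals [X K] there, so the vector is in
    [X F^(j+1)] applied to something. *)
Lemma casimir_no_odd_block d : odd d -> d != 1%N -> no_block X d.
Proof.
move=> odd_d d_neq1; have [j dE] : exists j, d = (2 * j.+1).+1.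
  exists (d./2.-1); rewrite prednK; last by case: d odd_d d_neq1 => [|[|[|]]].
  by rewrite mul2n -[LHS]odd_double_half odd_d.
apply: no_block_square => v; rewrite {}dE [_.-1]/= exprS exprM expr2 XX => XFv.
set A := X * F ^+ j.+1 in XFv *.
(* The columns of [Z] span the kernel of [A], so those of [F^(j+1) Z] span the kernel of [X] in the
   image of [F^(j+1)]. *)
pose Z := (kermx A^T)^T.
have AZ : A * Z = 0 by apply: trmx_inj; rewrite -mulmxE trmx_mul trmxK mulmx_ker trmx0.
have kerA w : A * w = 0 -> exists y, w = Z * y.
  move=> Aw; have /submxP[y wE] : (w^T <= kermx A^T)%MS.
    by apply/sub_kermxP; rewrite -trmx_mul mulmxE Aw trmx0.
  by exists y^T; rewrite -[LHS]trmxK wE trmx_mul.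
have FjD : F ^+ j.+1 * D = D * F ^+ j.+1.
  by apply/esym/commrX; rewrite /GRing.comm FD.
have [C DZ] : exists C, D * Z = Z * C.
  by apply: kerA; rewrite /A mulrA -[X * _ * D]mulrA FjD mulrA XD -!mulrA [X * _]mulrA AZ mulr0.
have [||C' SE] := @stable_injective_onto D (F ^+ j.+1 * Z) C.
- by rewrite mulrA -FjD -mulrA DZ mulrA.
- move=> y; rewrite -mulrA => Dy; apply: casimir_homotopy_inj Dy.
  by rewrite mulrA [X * _ * _]mulrA AZ mul0r.
have [y ->] := kerA _ XFv; exists (K * Z * C' * y).
have FjK : F ^+ j.+1 * K = K * F ^+ j.+1.
  by apply/esym/commrX; rewrite /GRing.comm FK.
(* The term [K X] of [D] vanishes on [F^(j+1) Z]. *)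
have DSE : D * (F ^+ j.+1 * Z) = A * (K * Z).
  rewrite DE mulrDl -[K * X * _]mulrA [X * (_ * Z)]mulrA AZ mulr0 addr0.
  by rewrite -mulrA [K * (_ * Z)]mulrA -FjK !mulrA.
by rewrite [LHS]mulrA SE DSE !mulrA.
Qed.

End CasimirHomotopy.

Lemma null_homotopic_no_odd_block d : (Q + If) * (Q + If) = F ->
  odd d -> d != 1%N -> no_block (Q + If) d.
Proof. by move=> XX; apply: (@casimir_no_odd_block (Q + If)). Qed.

End NullHomotopic.
End Triple.
End Sl2.

(** * Models of regular nilpotent matrices *)

Section Models.
Variable k : fieldType.

Lemma nilpotent_regular_jordan n (N : 'M[k]_n) : (0 < n)%N -> N ^+ n = 0 -> N ^+ n.-1 != 0 ->
  exists2 u, u \in unitmx & u *m N = jordan_block k n *m u.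
Proof.
case: n N => // n N _ Nn Nn1; have [U [Phi [UN _]]] := nilpotent_chain Nn Nn1.
by rewrite unitmx_mul => /andP[uU _]; exists U.
Qed.

Lemma nilpotent_regular_similar n (N N' : 'M[k]_n) : (0 < n)%N ->
  N ^+ n = 0 -> N ^+ n.-1 != 0 -> N' ^+ n = 0 -> N' ^+ n.-1 != 0 ->
  exists w v, [/\ w *m v = 1%:M, v *m w = 1%:M & N = v *m N' *m w].
Proof.
move=> n_gt0 Nn Nn1 Nn' Nn1'.
have [u uU uN] := nilpotent_regular_jordan n_gt0 Nn Nn1.
have [u' uU' uN'] := nilpotent_regular_jordan n_gt0 Nn' Nn1'.
exists (invmx u' *m u), (invmx u *m u'); split.
- by rewrite mulmxA mulmxK // mulVmx.
- by rewrite mulmxA mulmxK // mulVmx.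
by rewrite !mulmxA -[_ *m u' *m N']mulmxA uN' mulmxA mulmxK // -mulmxA -uN mulKmx.
Qed.

Section WeightedShift.
Variables (n r : nat) (c h : nat -> k).

(** The raising operator for a lowering operator equal to the power [r] of the Jordan block. *)
Definition raising_mx : 'M[k]_n := \matrix_(i, j) ((j + r == i)%N%:R * c j).
Definition weight_mx : 'M[k]_n := diag_mx (\row_i h i).

Lemma weight_raising : (forall i, h (i + r)%N = h i + 2%:R) ->
  weight_mx * raising_mx = raising_mx * weight_mx + raising_mx *+ 2.
Proof.
move=> hr; rewrite -!mulmxE mul_diag_mx mul_mx_diag; apply/matrixP => i j; rewrite !mxE.
by case: eqP => [<-|_]; rewrite ?hr /=; ring.
Qed.

Lemma weight_shift s a : (forall i, h (i + s)%N = h i + a) ->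
  weight_mx * jordan_block k n ^+ s = jordan_block k n ^+ s * weight_mx - a *: jordan_block k n ^+ s.
Proof.
move=> hs; rewrite jordan_blockX -!mulmxE mul_diag_mx mul_mx_diag.
apply/matrixP => i j; rewrite !mxE.
by case: eqP => [<-|_]; rewrite ?hs /=; ring.
Qed.

(** Both products are diagonal and the hypothesis compares their entries; its boolean factors record
    where a shift by [r] leaves the index range. *)
Lemma raising_shift :
  (forall i, (i < n)%N ->
    (r <= i)%N%:R * c (i - r)%N = (i + r < n)%N%:R * c i + h i) ->
  raising_mx * jordan_block k n ^+ r = jordan_block k n ^+ r * raising_mx + weight_mx.
Proof.
move=> ch; rewrite jordan_blockX; apply/matrixP => i j; rewrite !mxE.
have -> : \sum_l raising_mx i l * (\matrix_(a, b) (a + r == b)%N%:R : 'M[k]_n) l j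
    = (i == j)%:R * ((r <= i)%N%:R * c (i - r)%N).
  have [le_ri|lt_ir] := leqP r i; last first.
    rewrite mul0r mulr0 big1 // => l _; rewrite !mxE.
    by case: eqP => [e|_]; [rewrite -e ltnNge leq_addl in lt_ir | rewrite !mul0r].
  have lt_n : (i - r < n)%N by rewrite (leq_ltn_trans (leq_subr _ _)).
  rewrite (bigD1 (Ordinal lt_n)) //= !mxE /= subnK // eqxx val_eqE big1; first by rewrite addr0 mulrC mul1r.
  move=> l ne; rewrite !mxE; case: eqP => [e|_]; last by rewrite !mul0r.
  by case/eqP: ne; apply: val_inj; rewrite /= -e addnK.
have -> : \sum_l (\matrix_(a, b) (a + r == b)%N%:R : 'M[k]_n) i l * raising_mx l j
    = (i == j)%:R * ((i + r < n)%N%:R * c i).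
  have [lt_n|ge_n] := ltnP (i + r) n; last first.
    rewrite mul0r mulr0 big1 // => l _; rewrite !mxE.
    by case: eqP => [e|_]; [rewrite e leqNgt ltn_ord in ge_n | rewrite !mul0r].
  rewrite (bigD1 (Ordinal lt_n)) //= !mxE /= eqxx eqn_add2r eq_sym val_eqE big1 ?addr0.
    by rewrite !mul1r; case: eqP => [->|]; rewrite ?mul0r.
  move=> l ne; rewrite !mxE; case: eqP => [e|_]; last by rewrite !mul0r.
  by case/eqP: ne; apply: val_inj.
by rewrite ch // mulrDr -val_eqE; case: eqP => _; rewrite !(mul1r, mul0r, mulr1n, mulr0n).
Qed.
End WeightedShift.

(** Stated over possibly zero rings, so that matrices of size 0 are covered. *)
Definition sl2_rel (R : pzRingType) (e h f : R) :=
  [/\ h * e = e * h + e *+ 2, h * f = f * h - f *+ 2 & e * f = f * e + h].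

Lemma jordan_block_sl2 n : exists e h, sl2_rel e h (jordan_block k n).
Proof.
(* Raising coefficients and weights of the irreducible module of dimension [n]; [c] vanishes at the
   last index, where the shift is cut off. *)
pose c i : k := i.+1%:R * (n%:R - i.+1%:R).
pose h i : k := (2 * i)%:R + 1 - n%:R.
exists (raising_mx n 1 c), (weight_mx n h).
have hr i : h (i + 1)%N = h i + 2%:R by rewrite /h mulnDr natrD; ring.
have := @weight_shift n h 1 _ hr; have := @raising_shift n 1 c h; rewrite !expr1.
move=> EF HF; split; [exact: weight_raising | by rewrite HF scaler_nat | apply: EF => i lt_in].
have -> : (i + 1 < n)%N%:R * c i = c i.
  case: ltnP; rewrite ?mul1r // addn1 => le_ni.
  by rewrite mul0r /c (_ : n = i.+1) ?subrr ?mulr0 //; apply/eqP; rewrite eqn_leq le_ni.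
case: i lt_in => [|i] lt_in; rewrite /c /h /=; first by rewrite mul0r; ring.
by rewrite subn1 mul1r /=; rewrite mulnS natrD natrM -!natr1; ring.
Qed.

(** The square of the block is a sum of two chains, on the even and on the odd indices, of lengths
    [m + 1] and [m]. The weights [i - m] make both irreducible sl2-modules, and the block itself
    lowers them by 1. *)
Lemma jordan_block_sqr_sl2 m (n := m.*2.+1) : exists e h,
  sl2_rel e h (jordan_block k n ^+ 2) /\
  h * jordan_block k n = jordan_block k n * h - jordan_block k n.
Proof.
pose c i : k := i./2.+1%:R * (m%:R - (uphalf i)%:R).
pose h i : k := i%:R - m%:R.
exists (raising_mx n 2 c), (weight_mx n h).
have hr i : h (i + 2)%N = h i + 2%:R by rewrite /h natrD; ring.
have h1 i : h (i + 1)%N = h i + 1 by rewrite /h natrD; ring.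
have := @weight_shift n h 1 _ h1; rewrite expr1 scale1r => ->; split=> //.
split; first exact: weight_raising.
  by rewrite (@weight_shift n h 2 _ hr) scaler_nat.
apply: raising_shift => i lt_in.
have -> : (i + 2 < n)%N%:R * c i = c i.
  case: ltnP; rewrite ?mul1r // mul0r => le_n.
  by rewrite /c (_ : uphalf i = m) ?subrr ?mulr0 //; lia.
case: i lt_in => [|[|i]] lt_in; rewrite /c /h /=; [by rewrite mul0r; ring | by rewrite mul0r; ring |].
rewrite mul1r subSS subSS subn0.
have iE : i%:R = i./2%:R + (uphalf i)%:R :> k by rewrite -natrD; congr _%:R; lia.
by rewrite -!natr1 iE; ring.
Qed.

Lemma odd_regular_sqr_sl2 n (B : 'M[k]_n) : odd n -> B ^+ n = 0 -> B ^+ n.-1 != 0 ->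
  exists E H, sl2_rel E H (B * B) /\ H * B = B * H - B.
Proof.
move=> odd_n Bn Bn1; have n_gt0 := odd_gt0 odd_n.
have [w [v [wv vw BE]]] := nilpotent_regular_similar n_gt0 Bn Bn1
  (jordan_block_nilp k n) (@jordan_blockX_neq0 k n n.-1 (ltac:(by rewrite prednK))).
have [m nE] : exists m, n = m.*2.+1.
  by exists n./2; rewrite -[LHS]odd_double_half odd_n.
pose f X : 'M[k]_n := v *m X *m w.
have fM X Y : f X * f Y = f (X * Y).
  by rewrite /f -!mulmxE !mulmxA -[v *m X *m w *m v]mulmxA wv mulmx1.
have fD X Y : f (X + Y) = f X + f Y by rewrite /f mulmxDr mulmxDl.
have fB X Y : f (X - Y) = f X - f Y by rewrite /f mulmxBr mulmxBl.
have fMn X : f (X *+ 2) = f X *+ 2 by rewrite !mulr2n fD.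
have : exists E H, sl2_rel E H (jordan_block k n ^+ 2) /\
    H * jordan_block k n = jordan_block k n * H - jordan_block k n.
  by rewrite nE; apply: jordan_block_sqr_sl2.
case=> E [H [[HE HF EF] HJ]]; exists (f E), (f H); rewrite BE -/(f _) !fM -expr2.
split; last by rewrite HJ fB.
by split; rewrite !fM -?fMn -?fB -?fD ?HE ?HF ?EF.
Qed.

(** On [k^m (x) k^2] the triple acts on the first factor, while [P] and [R] are the two off-diagonal
    matrix units of the second. [P] will give [Q], and [Y R] the homotopy of [Y]. *)
Lemma even_regular_sqr_sl2 n (B : 'M[k]_n) : (0 < n)%N -> ~~ odd n ->
    B ^+ n = 0 -> B ^+ n.-1 != 0 ->
  exists E H P R, let F := B * B in
    [/\ sl2_rel E H F, B = P + F * R, P * R + R * P = 1,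
        [/\ P * E = E * P, P * H = H * P & P * F = F * P]
      & [/\ R * E = E * R, R * H = H * R & R * F = F * R]].
Proof.
move=> n_gt0 even_n; have [m nE] : exists m, n = (m + m)%N.
  by exists n./2; rewrite addnn even_halfK.
subst n => Bn Bn1; clear even_n.
have m_gt0 : (0 < m)%N by lia.
pose J := jordan_block k m; pose P : 'M[k]_(m + m) := block_mx 0 1 0 0.
pose R : 'M[k]_(m + m) := block_mx 0 0 1 0; pose A : 'M[k]_(m + m) := block_mx 0 1 J 0.
have bM (a b c d a' b' c' d' : 'M[k]_m) :
  (block_mx a b c d : 'M_(m + m)) * block_mx a' b' c' d' =
  block_mx (a * a' + b * c') (a * b' + b * d') (c * a' + d * c') (c * b' + d * d').
  exact: mulmx_block.
pose simp := (mulr0, mul0r, mulr1, mul1r, addr0, add0r).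
have AA : A * A = block_mx J 0 0 J by rewrite bM !simp.
(* [A] is nilpotent of index exactly [2 m], so it is conjugate to [B]. *)
have An : A ^+ (m + m) = 0.
  have mm : (m + m = 2 * m)%N by lia.
  by rewrite [LHS](congr1 (GRing.exp A) mm) exprM expr2 AA block_diagX jordan_block_nilp block_mx0.
have An1 : A ^+ (m + m).-1 != 0.
  have -> : (m + m).-1 = (2 * m.-1).+1 by lia.
  rewrite exprS exprM expr2 AA block_diagX bM !simp; apply/eqP.
  rewrite -[RHS]block_mx0 => /eq_block_mx[_ /eqP Jm _ _]; move: Jm.
  by apply/negP; rewrite jordan_blockX_neq0 // prednK.
have [w [v [wv vw BE]]] := nilpotent_regular_similar n_gt0 Bn Bn1 An An1.
pose f X : 'M[k]_(m + m) := v *m X *m w.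
have fM X Y : f X * f Y = f (X * Y).
  by rewrite /f -!mulmxE !mulmxA -[v *m X *m w *m v]mulmxA wv mulmx1.
have fD X Y : f (X + Y) = f X + f Y by rewrite /f mulmxDr mulmxDl.
have fB X Y : f (X - Y) = f X - f Y by rewrite /f mulmxBr mulmxBl.
have fMn X : f (X *+ 2) = f X *+ 2 by rewrite !mulr2n fD.
have f1 : f 1 = 1 by rewrite /f mulmx1 vw.
have [e [h [he hf ef]]] := jordan_block_sl2 m.
pose dg (a : 'M[k]_m) : 'M[k]_(m + m) := block_mx a 0 0 a.
have dM a b : dg a * dg b = dg (a * b) by rewrite bM !simp.
have dD a b : dg a + dg b = dg (a + b) by rewrite /dg add_block_mx !addr0.
have dB a b : dg a - dg b = dg (a - b) by rewrite /dg opp_block_mx add_block_mx oppr0 !addr0.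
have dMn a : dg a *+ 2 = dg (a *+ 2) by rewrite !mulr2n dD.
have dP a : P * dg a = dg a * P by rewrite !bM !simp.
have dR a : R * dg a = dg a * R by rewrite !bM !simp.
exists (f (dg e)), (f (dg h)), (f P), (f R); rewrite BE -/(f A) /= !fM AA -/(dg J).
split.
- by split; rewrite ?fM -?fMn -?fB -?fD !dM ?dMn ?dD ?dB ?he ?hf ?ef.
- by rewrite ?fM -fD /dg bM !simp add_block_mx !simp.
- by rewrite ?fM -fD !bM !simp add_block_mx !simp -[RHS]f1 -scalar_mx_block.
- by split; rewrite ?fM dP.
by split; rewrite ?fM dR.
Qed.

End Models.

(** * Modules over q(n) *)

Section Queer.
Variable k : fieldType.

Lemma hpart_parity p q a b (X : 'M[k]_(p + q)) : has_parity a X ->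
  hpart b X = if a == b then X else 0.
Proof.
move=> Xa; case: eqP => [<- //|]; rewrite -Xa.
case: a b {Xa} => -[] // _; rewrite /hpart.
  by rewrite block_mxKul block_mxKdr block_mx0.
by rewrite block_mxKur block_mxKdl block_mx0.
Qed.

Lemma sbracket_homogeneous p q a b (X Y : 'M[k]_(p + q)) :
  has_parity a X -> has_parity b Y ->
  sbracket X Y = X *m Y - (-1) ^+ (a && b) *: (Y *m X).
Proof.
move=> Xa Yb; rewrite /sbracket !big_bool !(hpart_parity _ Xa) !(hpart_parity _ Yb).
by case: a b {Xa Yb} => -[] /=; rewrite !(mul0mx, mulmx0, scaler0, subr0, oppr0, addr0, add0r).
Qed.

Definition queer_even n (A : 'M[k]_n) : 'M[k]_(n + n) := block_mx A 0 0 A.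
Definition queer_odd n (A : 'M[k]_n) : 'M[k]_(n + n) := block_mx 0 A A 0.

Lemma queer_even_queer n (A : 'M[k]_n) : queer (queer_even A).
Proof. by exists A, 0. Qed.

Lemma queer_odd_queer n (A : 'M[k]_n) : queer (queer_odd A).
Proof. by exists 0, A. Qed.

Lemma queer_even_parity n (A : 'M[k]_n) : has_parity false (queer_even A).
Proof. by rewrite /has_parity /hpart block_mxKul block_mxKdr. Qed.

Lemma queer_odd_parity n (A : 'M[k]_n) : has_parity true (queer_odd A).
Proof. by rewrite /has_parity /hpart block_mxKur block_mxKdl. Qed.

Lemma queer_evenP n (X : 'M[k]_(n + n)) : queer X -> has_parity false X ->
  X = queer_even (ulsubmx X).
Proof.
case=> A [B ->]; rewrite /has_parity /hpart block_mxKul block_mxKdr.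
by case/eq_block_mx=> _ <-.
Qed.

Lemma queer_oddP n (X : 'M[k]_(n + n)) : queer X -> has_parity true X ->
  X = queer_odd (ursubmx X).
Proof.
case=> A [B ->]; rewrite /has_parity /hpart block_mxKur block_mxKdl.
by case/eq_block_mx=> <-.
Qed.

Lemma queer_even_inj n : injective (@queer_even n).
Proof. by move=> A B /eq_block_mx[]. Qed.

Lemma queer_evenZ n a (A : 'M[k]_n) : a *: queer_even A = queer_even (a *: A).
Proof. by rewrite /queer_even scale_block_mx !scaler0. Qed.

Lemma queer_oddZ n a (A : 'M[k]_n) : a *: queer_odd A = queer_odd (a *: A).
Proof. by rewrite /queer_odd scale_block_mx !scaler0. Qed.

Lemma queer_evenD n (A B : 'M[k]_n) : queer_even A + queer_even B = queer_even (A + B).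
Proof. by rewrite /queer_even add_block_mx !addr0. Qed.

Lemma queer_oddD n (A B : 'M[k]_n) : queer_odd A + queer_odd B = queer_odd (A + B).
Proof. by rewrite /queer_odd add_block_mx !addr0. Qed.

Lemma sbracket_even_even n (A B : 'M[k]_n) :
  sbracket (queer_even A) (queer_even B) = queer_even (A * B - B * A).
Proof.
rewrite (sbracket_homogeneous (queer_even_parity A) (queer_even_parity B)) scale1r.
by rewrite !mulmx_block !(mul0mx, mulmx0, addr0, add0r) opp_block_mx add_block_mx subr0.
Qed.

Lemma sbracket_even_odd n (A B : 'M[k]_n) :
  sbracket (queer_even A) (queer_odd B) = queer_odd (A * B - B * A).
Proof.
rewrite (sbracket_homogeneous (queer_even_parity A) (queer_odd_parity B)) scale1r.
by rewrite !mulmx_block !(mul0mx, mulmx0, addr0, add0r) opp_block_mx add_block_mx subr0.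
Qed.

Lemma sbracket_odd_odd n (A B : 'M[k]_n) :
  sbracket (queer_odd A) (queer_odd B) = queer_even (A * B + B * A).
Proof.
rewrite (sbracket_homogeneous (queer_odd_parity A) (queer_odd_parity B)) scaleN1r opprK.
by rewrite !mulmx_block !(mul0mx, mulmx0, addr0, add0r) add_block_mx addr0.
Qed.

Section Module.
Variables (n p q : nat) (rho : 'M[k]_(n + n) -> 'M[k]_(p + q)).
Hypothesis rho_mod : queer_module rho.

Let rho_lin a X Y : queer X -> queer Y -> rho (a *: X + Y) = a *: rho X + rho Y.
Proof. by case: rho_mod => + _ _; apply. Qed.

Definition rho_even A := rho (queer_even A).
Definition rho_odd A := rho (queer_odd A).

Lemma rho_evenD A B : rho_even (A + B) = rho_even A + rho_even B.
Proof.
by rewrite /rho_even -queer_evenD -[queer_even A]scale1r rho_lin ?scale1r //;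
  exact: queer_even_queer.
Qed.

Lemma rho_oddD A B : rho_odd (A + B) = rho_odd A + rho_odd B.
Proof.
by rewrite /rho_odd -queer_oddD -[queer_odd A]scale1r rho_lin ?scale1r //;
  exact: queer_odd_queer.
Qed.

Lemma rho_odd0 : rho_odd 0 = 0.
Proof. by apply: (addrI (rho_odd 0)); rewrite -rho_oddD !addr0. Qed.

Lemma rho_even0 : rho_even 0 = 0.
Proof. by apply: (addrI (rho_even 0)); rewrite -rho_evenD !addr0. Qed.

Lemma rho_oddN A : rho_odd (- A) = - rho_odd A.
Proof. by apply: (addrI (rho_odd A)); rewrite -rho_oddD !subrr rho_odd0. Qed.

Lemma rho_evenN A : rho_even (- A) = - rho_even A.
Proof. by apply: (addrI (rho_even A)); rewrite -rho_evenD !subrr rho_even0. Qed.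

Let parity_even A : has_parity false (rho_even A).
Proof. by case: rho_mod => _ par _; apply: par (queer_even_queer _) (queer_even_parity _). Qed.

Let parity_odd A : has_parity true (rho_odd A).
Proof. by case: rho_mod => _ par _; apply: par (queer_odd_queer _) (queer_odd_parity _). Qed.

Let rho_bracket X Y : queer X -> queer Y -> rho (sbracket X Y) = sbracket (rho X) (rho Y).
Proof. by case: rho_mod => _ _; apply. Qed.

Lemma rho_even_even A B :
  rho_even A * rho_even B = rho_even B * rho_even A + rho_even (A * B - B * A).
Proof.
rewrite [rho_even (_ - _)]/rho_even -sbracket_even_even rho_bracket; try exact: queer_even_queer.
rewrite (sbracket_homogeneous (parity_even A) (parity_even B)) scale1r.
by rewrite !mulmxE addrC subrK.
Qed.

Lemma rho_even_odd A B :
  rho_even A * rho_odd B = rho_odd B * rho_even A + rho_odd (A * B - B * A).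
Proof.
rewrite [rho_odd (_ - _)]/rho_odd -sbracket_even_odd rho_bracket; 
  [|exact: queer_even_queer|exact: queer_odd_queer].
rewrite (sbracket_homogeneous (parity_even A) (parity_odd B)) scale1r.
by rewrite !mulmxE addrC subrK.
Qed.

Lemma rho_odd_odd A B :
  rho_odd A * rho_odd B + rho_odd B * rho_odd A = rho_even (A * B + B * A).
Proof.
rewrite /rho_even -sbracket_odd_odd rho_bracket; try exact: queer_odd_queer.
by rewrite (sbracket_homogeneous (parity_odd A) (parity_odd B)) scaleN1r opprK.
Qed.

Lemma rho_sl2 E H F : sl2_rel E H F -> sl2_rel (rho_even E) (rho_even H) (rho_even F).
Proof.
case=> HE HF EF; split; rewrite rho_even_even ?HE ?HF ?EF addrAC subrr add0r //.
  by rewrite mulr2n rho_evenD.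
by rewrite mulr2n rho_evenN rho_evenD.
Qed.

End Module.
End Queer.

(** * Jordan blocks of a regular nilpotent odd element on representations *)

Section NeatBalanced.
Variable k : closedFieldType.
Hypothesis char0 : [pchar k] =i pred0.
Variables (n : nat) (B : 'M[k]_n).
Hypotheses (Bn : B ^+ n = 0) (Bn1 : B ^+ n.-1 != 0).

Let two_neq0 : (2%:R : k) != 0.
Proof. by rewrite pchar0_natr_eq0. Qed.

Lemma rho_odd_sqr p q (rho : 'M[k]_(n + n) -> 'M[k]_(p + q)) A : queer_module rho ->
  rho_odd rho A * rho_odd rho A = rho_even rho (A * A).
Proof.
move=> mod; have /eqP := rho_odd_odd mod A A.
rewrite rho_evenD // -!mulr2n -!scaler_nat -subr_eq0 -scalerBr scaler_eq0 (negPf two_neq0).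
by rewrite subr_eq0 => /eqP.
Qed.

(** Treated apart because the weight arguments concern matrices of size [m.+1]. *)
Lemma all_jordan_sizes_thin good (T : 'M[k]_0) : all_jordan_sizes good T.
Proof.
apply: nilpotent_jordan_sizes; first by exists 0%N; rewrite [LHS]thinmx0 [RHS]thinmx0.
by move=> d _ _ v _; exists 0; rewrite [LHS]flatmx0 [RHS]flatmx0.
Qed.

Lemma weighted_sqrt_jordan_sizes m (E H X : 'M[k]_m) :
  sl2_rel E H (X * X) -> H * X = X * H - X -> all_jordan_sizes odd X.
Proof.
case: m => [|m] in E H X *; first by move=> *; apply: all_jordan_sizes_thin.
case=> HE HF EF HX; apply: nilpotent_jordan_sizes.
  by have [i Xi] := lowering_nilp char0 HF; exists (2 * i)%N; rewrite exprM expr2.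
by move=> d d_gt0; apply: (weighted_sqrt_no_even_block char0 HE HF EF erefl HX).
Qed.

Lemma null_homotopic_jordan_sizes m (E H F Q Ie Ih If : 'M[k]_m) :
    sl2_rel E H F ->
    [/\ Q * E = E * Q, Q * H = H * Q & Q * F = F * Q] ->
    [/\ Q * Ie + Ie * Q = E, Q * Ih + Ih * Q = H & Q * If + If * Q = F] ->
    [/\ H * Ie = Ie * H + Ie *+ 2, H * Ih = Ih * H & H * If = If * H - If *+ 2] ->
    [/\ F * Ie = Ie * F - Ih, F * Ih = Ih * F + If *+ 2 & F * If = If * F] ->
    (Q + If) * (Q + If) = F ->
  all_jordan_sizes (fun d => (d == 1)%N || ~~ odd d) (Q + If).
Proof.
case: m => [|m] in E H F Q Ie Ih If *; first by move=> *; apply: all_jordan_sizes_thin.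
case=> HE HF EF [QE QH QF] [QIe QIh QIf] [HIe HIh HIf] [FIe FIh FIf] XX.
apply: nilpotent_jordan_sizes.
  by have [i Xi] := lowering_nilp char0 HF; exists (2 * i)%N; rewrite exprM expr2 XX.
move=> d _; rewrite negb_or negbK => /andP[d_neq1 odd_d].
by apply: (null_homotopic_no_odd_block char0 HE HF EF QE QH QF QIe QIh QIf).
Qed.

(** The triple and the relation [[H, B] = -B] live in q(n), hence hold in every representation. *)
Lemma odd_regular_neat : odd n -> neat (queer_odd B).
Proof.
move=> odd_n p q rho [mod _]; rewrite -/(rho_odd rho B).
have [E [H [sl2 HB]]] := odd_regular_sqr_sl2 odd_n Bn Bn1.
apply: weighted_sqrt_jordan_sizes; first by rewrite rho_odd_sqr //; apply: rho_sl2 sl2.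
by rewrite rho_even_odd // HB addrAC subrr add0r rho_oddN.
Qed.

(** [Q] is the image of the odd element [P], and the homotopy of [Y] is the image of the odd element
    [Y R]: for [Y] commuting with [P], [P Y R + Y R P = Y (P R + R P) = Y]. *)
Lemma even_regular_balanced : (0 < n)%N -> ~~ odd n -> balanced (queer_odd B).
Proof.
move=> n_gt0 even_n p q rho [mod _]; rewrite -/(rho_odd rho B).
have [E [H [P [R [sl2 BE PR [PE PH PF] [RE RH RF]]]]]] :=
  even_regular_sqr_sl2 n_gt0 even_n Bn Bn1.
have XX := rho_odd_sqr B mod; move: sl2 BE XX PF RF.
set F := B * B => sl2 BE; rewrite BE rho_oddD // => XX PF RF.
have oddP Y : P * Y = Y * P -> rho_odd rho P * rho_even rho Y = rho_even rho Y * rho_odd rho P.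
  by move=> PY; rewrite rho_even_odd // PY subrr rho_odd0 // addr0.
have homot Y : P * Y = Y * P -> rho_odd rho P * rho_odd rho (Y * R) +
    rho_odd rho (Y * R) * rho_odd rho P = rho_even rho Y.
  by move=> PY; rewrite rho_odd_odd // mulrA PY -!mulrA -mulrDr PR mulr1.
have brR Y Z : R * Y = Y * R -> rho_even rho Y * rho_odd rho (Z * R) =
    rho_odd rho (Z * R) * rho_even rho Y + rho_odd rho ((Y * Z - Z * Y) * R).
  by move=> RY; rewrite rho_even_odd // -[Z * R * Y]mulrA RY !mulrA mulrBl.
have double Y : rho_odd rho (Y *+ 2) = rho_odd rho Y *+ 2 by rewrite !mulr2n rho_oddD.
have [HE HF EF] := sl2.
apply: (null_homotopic_jordan_sizes (E := rho_even rho E) (H := rho_even rho H)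
  (F := rho_even rho F) (Ie := rho_odd rho (E * R)) (Ih := rho_odd rho (H * R))) => //.
- exact: rho_sl2.
- by split; apply: oddP.
- by split; apply: homot.
- split; rewrite brR // ?subrr ?mul0r ?rho_odd0 ?addr0 //.
    by rewrite HE addrAC subrr add0r mulrnAl double.
  by rewrite HF addrAC subrr add0r mulNr rho_oddN // mulrnAl double.
split; rewrite brR // ?subrr ?mul0r ?rho_odd0 ?addr0 //.
  by rewrite EF opprD addrA subrr add0r mulNr rho_oddN.
by rewrite HF opprD opprK addrA subrr add0r mulrnAl double.
Qed.

End NeatBalanced.

(** * Centralizers *)

Section Centralizers.
Variable k : fieldType.

Lemma memmx_cent n (A X : 'M[k]_n) : (X \in 'C(mxvec A))%MS = (A * X == X * A).
Proof.
apply/cent_mxP/eqP => [|AX Y]; first by apply; apply: submx_refl.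
by case/submxP => c; rewrite [c]mx11_scalar mul_scalar_mx -linearZ => /(can_inj mxvecK) ->;
  rewrite -scalemxAl -scalemxAr -!mulmxE in AX *; rewrite AX.
Qed.

(** The first row of a Jordan basis generates: the powers of [N] send it to the successive rows. *)
Lemma regular_nilpotent_cyclic n (N : 'M[k]_n) : (0 < n)%N ->
  N ^+ n = 0 -> N ^+ n.-1 != 0 ->
  exists v : 'rV_n, row_free (\matrix_(i < n) (v *m N ^+ i)).
Proof.
move=> n_gt0 Nn Nn1; have [u uU uN] := nilpotent_regular_jordan n_gt0 Nn Nn1.
exists (row (Ordinal n_gt0) u); rewrite row_free_unit.
rewrite (_ : \matrix_i _ = u) //; apply/row_matrixP => i.
rewrite rowK [row _ u]rowE -mulmxA (intertwineX _ uN) mulmxA [row i u]rowE; congr (_ *m _).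
rewrite -rowE jordan_blockX; apply/rowP => b; rewrite !mxE eqxx /= add0n eq_sym.
by rewrite val_eqE.
Qed.

Lemma cyclic_cent_eq0 n (N X : 'M[k]_n) (v : 'rV_n) :
  row_free (\matrix_(i < n) (v *m N ^+ i)) -> X * N = N * X -> v *m X = 0 -> X = 0.
Proof.
rewrite row_free_unit => uU XN vX; apply: (can_inj (mulKmx uU)); rewrite mulmx0.
apply/row_matrixP => i; rewrite row_mul rowK row0 -mulmxA -(intertwineX (X := X) i XN).
by rewrite mulmxA vX mul0mx.
Qed.

(** A matrix [X] of the centralizer is determined by [v X], a vector of length [n]. *)
Lemma rank_cent_cyclic n (N : 'M[k]_n) (v : 'rV_n) :
  row_free (\matrix_(i < n) (v *m N ^+ i)) -> (\rank 'C(mxvec N)%MS <= n)%N.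
Proof.
move=> vN; set C := cent_mx _; rewrite -(mxrank_mul_ker C (lin_mx (mulmx v))).
suff -> : (C :&: kermx (lin_mx (mulmx v)))%MS = 0.
  by rewrite mxrank0 addn0 (leq_trans (rank_leq_col _)) // mul1n.
apply/eqP/rowV0P => u; rewrite sub_capmx => /andP[uC /sub_kermxP].
rewrite -[u]vec_mxK mul_vec_lin /= in uC * => /(canRL mxvecK); rewrite linear0 => vu.
rewrite memmx_cent in uC; apply/eqP; rewrite mxvec_eq0; apply/eqP.
exact: (cyclic_cent_eq0 vN (esym (eqP uC))).
Qed.

(** The coordinates of [v X] in the basis [v N^i] define a polynomial in [N] that agrees with [X] on
    [v], hence everywhere. *)
Lemma cent_cyclic_poly n (N X : 'M[k]_n) (v : 'rV_n) :
  row_free (\matrix_(i < n) (v *m N ^+ i)) -> X * N = N * X ->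
  exists c : 'I_n -> k, X = \sum_(i < n) c i *: N ^+ i.
Proof.
move=> vN XN; set U := \matrix_i _ in vN.
have uU : U \in unitmx by rewrite -row_free_unit.
pose c := v *m X *m invmx U; exists (c 0); apply/eqP; rewrite -subr_eq0; apply/eqP.
apply: (cyclic_cent_eq0 vN).
  rewrite mulrBl mulrBr XN mulr_suml mulr_sumr; congr (_ - _); apply: eq_bigr => i _.
  by rewrite -!mulmxE -scalemxAl -scalemxAr; congr (_ *: _); rewrite !mulmxE -exprS -exprSr.
have cU : v *m X = c *m U by rewrite mulmxKV.
rewrite mulmxBr cU [c *m U]mulmx_sum_row mulmx_sumr -sumrB big1 // => i _.
by rewrite rowK -scalemxAr subrr.
Qed.

Lemma trig_mul n (A B : 'M[k]_n) : is_trig_mx A -> is_trig_mx B ->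
  forall i j : 'I_n, (i <= j)%N -> (A *m B) i j = (i == j)%:R * (A i i * B i i).
Proof.
move=> /is_trig_mxP At /is_trig_mxP Bt i j le_ij; rewrite mxE.
have [<-|ne_ij] := eqVneq i j.
  rewrite mul1r (bigD1 i) //= big1 ?addr0 // => l; rewrite -val_eqE neq_ltn.
  by case/orP => lt; rewrite ?(Bt _ _ lt) ?mulr0 // (At _ _ lt) mul0r.
have lt_ij : (i < j)%N by rewrite ltn_neqAle le_ij andbT.
rewrite mul0r big1 // => l _; have [le_li|lt_il] := leqP l i.
  by rewrite Bt ?mulr0 // (leq_ltn_trans le_li).
by rewrite At ?mul0r.
Qed.

Definition upper_part n (X : 'M[k]_n) : 'M[k]_n :=
  \matrix_(i, j) (if (i < j)%N then X i j else 0).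

Lemma upper_part_is_linear n : linear (@upper_part n).
Proof. by move=> a X Y; apply/matrixP => i j; rewrite !mxE; case: ifP; rewrite ?mulr0 ?addr0. Qed.
HB.instance Definition _ n := GRing.isLinear.Build k _ _ _ (@upper_part n) (@upper_part_is_linear n).

Lemma upper_part_eq0 n (X : 'M[k]_n) : reflect (upper_part X = 0) (is_trig_mx X).
Proof.
apply: (iffP is_trig_mxP) => [X0|/matrixP X0 i j lt_ij].
  by apply/matrixP => i j; rewrite !mxE; case: ifP => // /X0.
by have := X0 i j; rewrite !mxE lt_ij.
Qed.

Definition diag_part n (X : 'M[k]_n) : 'rV[k]_n := \row_i X i i.

Lemma diag_part_is_linear n : linear (@diag_part n).
Proof. by move=> a X Y; apply/matrixP => i j; rewrite !mxE. Qed.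
HB.instance Definition _ n := GRing.isLinear.Build k _ _ _ (@diag_part n) (@diag_part_is_linear n).

(* [b, b] lies in the nilradical n of the Borel subalgebra b of triangular
   matrices, so ad A, for A in b, has rank at most dim n on b. *)
Lemma rank_cent_trig n (A : 'M[k]_n) : is_trig_mx A -> (n <= \rank 'C(mxvec A)%MS)%N.
Proof.
move=> A_trig; pose ad := lin_mx (mulmxr A \- mulmx A).
pose b := kermx (lin_mx (@upper_part n)); pose dg := lin_mx (@diag_part n).
have mem_b X : (mxvec X <= b)%MS = is_trig_mx X.
  apply/sub_kermxP/upper_part_eq0; rewrite mul_vec_lin /=; last by move=> ->; rewrite linear0.
  by move/(canRL mxvecK); rewrite linear0.
have ad_b : (b *m ad <= b :&: kermx dg)%MS.
  apply/row_subP => i; rewrite row_mul -[row i b]vec_mxK; set X := vec_mx _.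
  have X_trig : is_trig_mx X by rewrite -mem_b vec_mxK row_sub.
  have adX (a c : 'I_n) : (a <= c)%N -> (X *m A - A *m X) a c = 0.
    by move=> le_ac; rewrite mxE [X in _ + X]mxE !trig_mul // [A a a * _]mulrC subrr.
  rewrite mul_vec_lin /= sub_capmx mem_b; apply/andP; split.
    by apply/is_trig_mxP => a c /ltnW /adX.
  apply/sub_kermxP; rewrite mul_vec_lin; apply/eqP; rewrite mxvec_eq0; apply/eqP.
  by apply/rowP => a; rewrite [LHS]mxE adX // [RHS]mxE.
have dg_b : (n <= \rank (b *m dg))%N.
  (* [W] embeds the diagonal matrices as a section of [dg]; [V] only undoes the vectorization. *)
  pose W := lin1_mx (mxvec \o @diag_mx k n); pose V := lin1_mx (@vec_mx k 1 n).
  have WE d : d *m W = mxvec (diag_mx d) by apply: mul_rV_lin1.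
  have VE u : u *m V = vec_mx u by apply: mul_rV_lin1.
  have WV : W *m dg *m V = 1%:M.
    apply/row_matrixP => i; rewrite !row_mul [row i W]rowE WE mul_vec_lin VE mxvecK row1.
    apply/rowP => j; rewrite !mxE eqxx /=.
    by rewrite eqxx mulr1n eq_sym.
  rewrite -{1}(mxrank1 k n) -WV (leq_trans (mxrankM_maxl _ _)) // mxrankS // submxMr //.
  apply/row_subP => i; rewrite rowE WE mem_b.
  by apply: is_diag_mx_is_trig; apply: diag_mx_is_diag.
have ker_b : (b :&: kermx ad <= 'C(mxvec A))%MS.
  apply/rV_subP => u; rewrite sub_capmx => /andP[_ /sub_kermxP].
  rewrite -[u]vec_mxK mul_vec_lin memmx_cent /= => /(canRL mxvecK); rewrite linear0.
  by move/eqP; rewrite subr_eq0 eq_sym.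
apply: (leq_trans dg_b); apply: leq_trans (mxrankS ker_b).
(* Rank-nullity on [b], once for [dg] and once for [ad], reduces the inequality to [ad_b]. *)
rewrite -(leq_add2r (\rank (b :&: kermx dg))) mxrank_mul_ker -(mxrank_mul_ker b ad) addnC.
by rewrite leq_add2l mxrankS.
Qed.

End Centralizers.

(** * Lower bound for the dimension of centralizers *)

Section Trigonalize.
Variable k : closedFieldType.

(** Conjugation by [P] embeds the centralizer of [T] into that of [A]. *)
Lemma rank_cent_similar n (A T : 'M[k]_n) P : P \in unitmx -> P *m A = T *m P ->
  (\rank 'C(mxvec T)%MS <= \rank 'C(mxvec A)%MS)%N.
Proof.
move=> uP PA; pose f := lin_mx (mulmx (invmx P) \o mulmxr P).
have fK : f *m lin_mx (mulmx P \o mulmxr (invmx P)) = 1%:M.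
  apply/row_matrixP => i; rewrite row_mul row1 [row i f]rowE -[delta_mx _ _]vec_mxK.
  by rewrite !mul_vec_lin /= !mulmxA mulmxV // mul1mx mulmxK.
have f_free : row_free f by apply/row_freeP; eexists; exact: fK.
rewrite -(mxrankMfree 'C(mxvec T)%MS f_free) mxrankS //.
apply/row_subP => i; rewrite row_mul -[row i _]vec_mxK; set X := vec_mx _.
have : (X \in 'C(mxvec T))%MS by rewrite vec_mxK row_sub.
rewrite mul_vec_lin !memmx_cent /= -!mulmxE => /eqP TX.
have AP : A *m invmx P = invmx P *m T.
  by apply: (can_inj (mulKmx uP)); rewrite mulmxA PA mulmxK // mulKVmx.
by rewrite !mulmxA AP -!mulmxA PA; rewrite !mulmxA -[_ *m T *m X]mulmxA TX !mulmxA.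
Qed.

Lemma exists_eigenvector n (A : 'M[k]_n) : (0 < n)%N ->
  exists a, exists2 v : 'rV_n, v *m A = a *: v & v != 0.
Proof.
move=> n_gt0; have /closed_rootP[a] : size (char_poly A) != 1%N.
  by rewrite size_char_poly eqSS -lt0n.
rewrite -eigenvalue_root_char => /eigenvalueP[v vA v0].
by exists a, v.
Qed.

Lemma trigonalize n (A : 'M[k]_n) :
  exists P T, [/\ P \in unitmx, is_trig_mx T & P *m A = T *m P].
Proof.
elim: n => [|n IHn] in A *.
  by exists 1%:M, A; rewrite unitmx1 mul1mx mulmx1; split=> //; apply/is_trig_mxP => -[].
have [a [v vA v0]] := exists_eigenvector A (ltn0Sn n).
(* The first row of [P] is a scalar multiple of [v], hence also an eigenvector. *)
pose P : 'M_(1 + n) := row_ebase v; have uP : P \in unitmx by apply: row_ebase_unit.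
have vE : v = col_ebase v *m usubmx P.
  have pidP : pid_mx 1 *m P = usubmx P.
    have -> : pid_mx 1 = row_mx 1%:M 0 :> 'M[k]_(1, 1 + n).
      by rewrite pid_mx_row.
    by rewrite -{1}[P]vsubmxK mul_row_col mul1mx mul0mx addr0.
  by rewrite -pidP mulmxA -{1}(mulmx_ebase v) rank_rV v0.
have uc : col_ebase v \in unitmx by apply: col_ebase_unit.
have PA : usubmx P *m A = a *: usubmx P.
  by apply: (can_inj (mulKmx uc)); rewrite mulmxA -vE vA -scalemxAr -vE.
pose B := (P *m A *m invmx P : 'M_(1 + n)).
have BE : B = block_mx a%:M 0 (dlsubmx B) (drsubmx B).
  have uPV : usubmx P *m invmx P = row_mx 1%:M 0.
    have := mulmxV uP; rewrite -{1}[P]vsubmxK mul_col_mx scalar_mx_block block_mxEv.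
    by case/eq_col_mx.
  rewrite -[LHS]submxK /ulsubmx /ursubmx; have -> : usubmx B = row_mx a%:M 0.
    rewrite /B -{1}[P]vsubmxK !mul_col_mx col_mxKu PA -scalemxAl uPV scale_row_mx scaler0.
    by rewrite scalemx1.
  by rewrite row_mxKl row_mxKr.
have BP : B *m P = P *m A by rewrite mulmxKV.
have [Q [T [uQ T_trig QT]]] := IHn (drsubmx B).
have uQ' : block_mx 1%:M 0 0 Q \in @unitmx _ (1 + n).
  by rewrite unitmxE det_ublock det1 mul1r -unitmxE.
have T'_trig : @is_trig_mx _ (1 + n) (1 + n) (block_mx a%:M 0 (Q *m dlsubmx B) T).
  by rewrite is_trig_block_mx // eqxx T_trig andbT; apply/is_trig_mxP => i j; rewrite !ord1.
have QB : (block_mx 1%:M 0 0 Q : 'M_(1 + n)) *m B =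
    block_mx a%:M 0 (Q *m dlsubmx B) T *m block_mx 1%:M 0 0 Q.
  by rewrite {1}BE !mulmx_block !(mul0mx, mulmx0, mul1mx, mulmx1, addr0, add0r) QT.
exists (block_mx 1%:M 0 0 Q *m P : 'M_(1 + n)), (block_mx a%:M 0 (Q *m dlsubmx B) T : 'M_(1 + n)).
split=> //; first by rewrite unitmx_mul uP andbT.
by rewrite -mulmxA -BP [RHS]mulmxA mulmxA QB.
Qed.

Lemma rank_cent_ge n (A : 'M[k]_n) : (n <= \rank 'C(mxvec A)%MS)%N.
Proof.
have [P [T [uP T_trig PA]]] := trigonalize A.
exact: leq_trans (rank_cent_trig T_trig) (rank_cent_similar uP PA).
Qed.

End Trigonalize.

(** * Distinguished elements *)

Section Distinguished.
Variable k : closedFieldType.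

Lemma idempotent_diagonalizable n (P : 'M[k]_n.+1) : P * P = P -> diagonalizable P.
Proof.
move=> PP; apply/diagonalizableP; exists [:: 0; 1]; first by rewrite /= inE eq_sym oner_eq0.
apply: mxminpoly_min; rewrite !big_cons big_nil mulr1 rmorphM !rmorphB /=.
by rewrite horner_mx_X !horner_mx_C raddf0 subr0 mulrBr PP mulr1 subrr.
Qed.

Lemma cent_all_scalar n (P : 'M[k]_n.+1) : (forall A, P * A = A * P) -> exists a, P = a%:M.
Proof.
move=> cP; exists (P 0 0); apply/matrixP => a i; have := cP (delta_mx i 0).
move=> /matrixP /(_ a 0); rewrite -!mulmxE -{1}[P]trmxK -[_ *m delta_mx _ _]trmxK trmx_mul trmxK.
rewrite trmx_delta !mxE (bigD1 i) //= big1 => [|l ne]; last first.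
  by rewrite !mxE (negPf ne) andbF mul0r.
rewrite (bigD1 0) //= big1 => [|l ne]; last by rewrite !mxE (negPf ne) andbF mul0r.
by rewrite !mxE !eqxx andbT mul1r !addr0 => ->; case: eqP; rewrite ?mul1r ?mul0r.
Qed.

(** [P] defines a semisimple even element commuting with [x]; being central, it is scalar. *)
Lemma distinguished_idempotent n (B P : 'M[k]_n.+1) : distinguished (queer_odd B) ->
  P * P = P -> P * B = B * P -> P = 0 \/ P = 1.
Proof.
move=> dist PP PB.
have [_ cP] : queer_center (queer_even P).
  apply: dist; last by rewrite sbracket_even_odd PB subrr /queer_odd block_mx0.
  split; [exact: queer_even_queer | exact: queer_even_parity |].
  by rewrite block_mxKul; apply: idempotent_diagonalizable.
have [A|a PE] := @cent_all_scalar _ P.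
  have := cP _ (queer_even_queer A); rewrite sbracket_even_even -block_mx0.
  by case/eq_block_mx => /eqP; rewrite subr_eq0 => /eqP.
move: PP; rewrite PE -mulmxE -scalar_mxM => /matrixP/(_ 0 0)/eqP; rewrite !mxE /= !mulr1n.
rewrite -subr_eq0 -{3}[a]mulr1 -mulrBr mulf_eq0 subr_eq0 => /orP[]/eqP->.
  by left; rewrite raddf0.
by right.
Qed.

(** The projection onto the generalized eigenspace of an eigenvalue [mu] is a polynomial in [B],
    hence 0 or 1. An eigenvector excludes 0. *)
Lemma distinguished_nilpotent n (B : 'M[k]_n.+1) : distinguished (queer_odd B) ->
  exists mu i, (B - mu%:M) ^+ i = 0.
Proof.
move=> dist; have [mu [v vB v0]] := exists_eigenvector B (ltn0Sn n).
have [m [q /implyP q_mu charE]] := multiplicity_XsubC (char_poly B) mu.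
exists mu, m; set N := B - mu%:M.
have NE : horner_mx B (('X - mu%:P) ^+ m) = N ^+ m.
  by rewrite rmorphXn /= rmorphB /= horner_mx_X horner_mx_C.
have co : coprimep q (('X - mu%:P) ^+ m).
  by rewrite coprimep_expr // coprimep_XsubC q_mu // monic_neq0 // char_poly_monic.
have /Bezout_eq1_coprimepP[[p1 p2] /= pq1] := co.
have qN : horner_mx B q * N ^+ m = 0 by rewrite -NE -rmorphM -charE /= Cayley_Hamilton.
set P := horner_mx B (p1 * q).
have P1 : P + horner_mx B p2 * N ^+ m = 1.
  by rewrite -NE -rmorphM -rmorphD pq1 rmorph1.
have PN : P * N ^+ m = 0 by rewrite /P rmorphM /= -mulrA qN mulr0.
have PP : P * P = P.
  rewrite -[in RHS](mulr1 P) -P1 mulrDr [P * (_ * _)]mulrA.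
  have -> : P * horner_mx B p2 = horner_mx B p2 * P by rewrite -!rmorphM mulrC.
  by rewrite -mulrA PN mulr0 addr0.
have PB : P * B = B * P.
  exact: (@comm_horner_mx _ _ B B (p1 * q) erefl).
have [P0|Peq1] := distinguished_idempotent dist PP PB; last by rewrite -PN Peq1 mul1r.
have vN : v *m N = 0 by rewrite mulmxBr vB mul_mx_scalar subrr.
(* Multiplicity 0 is impossible, since [mu] is a root of the characteristic polynomial. *)
case: m => [|m] in charE NE co pq1 qN P1 PN *.
  have /negP[] : ~~ root (char_poly B) mu.
    by rewrite charE expr0 mulr1 q_mu // monic_neq0 // char_poly_monic.
  by rewrite -eigenvalue_root_char; apply/eigenvalueP; exists v.
case/eqP: v0; rewrite -[v]mulmx1 -[1%:M]P1 P0 add0r.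
have -> : horner_mx B p2 * N ^+ m.+1 = N ^+ m.+1 * horner_mx B p2.
  by rewrite -NE -!rmorphM mulrC.
by rewrite exprS -!mulmxE !mulmxA vN !mul0mx.
Qed.

(** The projection onto a longest Jordan chain of [N] is a nonzero idempotent commuting with [B]. It
    is therefore 1, and the chain fills the space. *)
Lemma distinguished_regular n (B : 'M[k]_n.+1) : distinguished (queer_odd B) ->
  exists mu N, [/\ B = mu%:M + N, N ^+ n.+1 = 0 & N ^+ n != 0].
Proof.
move=> dist; have [mu nilN] := distinguished_nilpotent dist.
exists mu; set N := B - mu%:M in nilN *; exists N; rewrite addrC subrK.
have [|[|d] /eqP Nd min_d] := @ex_minnP (fun i => N ^+ i == 0).
- by case: nilN => i /eqP; exists i.
- by move/eqP: Nd; rewrite expr0 oner_eq0.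
have Nd' : N ^+ d != 0 by apply/negP => /min_d; rewrite ltnn.
have [U [Phi [UN NPhi uG]]] := nilpotent_chain Nd Nd'.
pose P := Phi *m invmx (U *m Phi) *m U.
have PN : P * N = N * P := chain_proj_comm UN NPhi uG.
have UP : U *m P = U by rewrite /P !mulmxA mulmxV // mul1mx.
have PP : P * P = P by rewrite -mulmxE {1}/P -[_ *m U *m P]mulmxA UP.
have PB : P * B = B * P.
  have -> : B = N + mu%:M by rewrite subrK.
  by rewrite mulrDr mulrDl PN; congr (_ + _); rewrite -!mulmxE scalar_mxC.
have [P0|P1] := distinguished_idempotent dist PP PB.
  have := uG; rewrite -UP P0 mulmx0 mul0mx unitmxE det0 unitr0 //.
have le_nd : (n.+1 <= d.+1)%N.
  rewrite -[X in (X <= _)%N](mxrank1 k) -[1%:M]P1.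
  by rewrite (leq_trans (mxrankM_maxr _ _)) ?rank_leq_row.
have le_dn : (d.+1 <= n.+1)%N.
  rewrite -[X in (X <= _)%N](mxrank_unit uG).
  by rewrite (leq_trans (mxrankM_maxl _ _)) ?rank_leq_col.
have nd : d = n by apply/eqP; rewrite eqn_leq -ltnS le_dn -ltnS.
by split=> //; [rewrite (congr1 (fun i => N ^+ i.+1) (esym nd))
  | rewrite (congr1 (fun i => N ^+ i) (esym nd))].
Qed.

End Distinguished.

(** * Jordan decomposition of the square of [mu + N] *)

Section JordanParts.
Variable k : fieldType.

Lemma nilpotent_comm_add n (X Y : 'M[k]_n) i j : X * Y = Y * X ->
  X ^+ i = 0 -> Y ^+ j = 0 -> (X + Y) ^+ (i + j) = 0.
Proof.
move=> XY Xi Yj; rewrite (exprDn_comm _ XY) big1 // => a _.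
have [le_ja|lt_aj] := leqP j a.
  by rewrite -(subnK le_ja) exprD Yj !mulr0 mul0rn.
have -> : (i + j - a = (j - a) + i)%N by lia.
by rewrite exprD Xi mulr0 mul0r mul0rn.
Qed.

Lemma diag_mxX n (d : 'rV[k]_n) i : diag_mx d ^+ i = diag_mx (\row_j d 0 j ^+ i).
Proof.
elim: i => [|i IHi]; first by apply/matrixP => a b; rewrite !mxE expr0.
rewrite exprS IHi -mulmxE mul_diag_mx; apply/matrixP => a b; rewrite !mxE exprS.
by rewrite mulrnAr.
Qed.

Lemma diagonalizable_nilpotent_scalar n (S : 'M[k]_n) c i :
  diagonalizable S -> (S - c%:M) ^+ i = 0 -> S = c%:M.
Proof.
case=> P uP /similar_diagPex[d /(similarLR uP)->].
rewrite conjumx ?unitmx_inv // invmxK => Si.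
have DPi : (diag_mx d - c%:M) *m P = P *m (invmx P *m diag_mx d *m P - c%:M).
  by rewrite mulmxBl mulmxBr !mulmxA mulmxV // mul1mx scalar_mxC.
have : diag_mx d - c%:M = diag_mx (\row_j (d 0 j - c)).
  by apply/matrixP => a b; rewrite !mxE -mulrnBl.
move=> dE; have : (diag_mx d - c%:M) ^+ i = 0.
  apply: (can_inj (mulmxK uP)).
  by rewrite -(intertwineX i (esym DPi)) Si mulmx0 mul0mx.
rewrite dE diag_mxX => /matrixP d0.
have -> : diag_mx d = c%:M.
  apply/matrixP => a b; rewrite !mxE; case: eqP => // _; have := d0 a a.
  by rewrite !mxE eqxx mulr1n => /eqP; rewrite expf_eq0 => /andP[_]; rewrite subr_eq0 => /eqP ->.
by rewrite -mulmxA -scalar_mxC mulmxA mulVmx // mul1mx.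
Qed.

Lemma comm_scalar_addr n (N : 'M[k]_n) c : GRing.comm N (c%:M + N).
Proof. by rewrite /GRing.comm mulrDr mulrDl -!mulmxE scalar_mxC. Qed.

(** Uniqueness of the Jordan decomposition: [M] and [F] are commuting nilpotents, so
    [S - mu^2 = M - F] is nilpotent as well as diagonalizable, hence 0. *)
Lemma jordan_parts_sqr n (B S F N : 'M[k]_n) mu i j :
  B = mu%:M + N -> N ^+ i = 0 -> diagonalizable S -> F ^+ j = 0 ->
  S * F = F * S -> B * B = S + F -> S = (mu ^+ 2)%:M /\ F = N * ((2%:R * mu)%:M + N).
Proof.
move=> BE Ni S_diag Fj SF BB; set M := N * (_ + N).
have muN : mu%:M * N = N * mu%:M by rewrite -!mulmxE scalar_mxC.
have BM : B * B = (mu ^+ 2)%:M + M.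
  rewrite /M BE mulrDl !mulrDr -mulmxE -scalar_mxM mulmxE -addrA; congr (_ + _).
  by rewrite muN addrA; congr (_ + _); rewrite -mulrDr -raddfD /= mulr_natl mulr2n.
have MF : M * F = F * M.
  have ->: M = S + F - (mu ^+ 2)%:M by rewrite -BB BM addrC addKr.
  by rewrite mulrBl mulrBr mulrDl mulrDr SF -!mulmxE scalar_mxC.
have Mi : M ^+ i = 0.
  by rewrite /M exprMn_comm ?Ni ?mul0r //; apply: comm_scalar_addr.
have SE : S = (mu ^+ 2)%:M.
  apply: (diagonalizable_nilpotent_scalar (i := i + j) S_diag).
  have -> : S - (mu ^+ 2)%:M = M - F.
    by apply/eqP; rewrite subr_eq addrAC eq_sym subr_eq [M + _]addrC -BM BB.
  by apply: nilpotent_comm_add; rewrite ?mulrN ?mulNr ?MF // exprNn Fj mulr0.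
by split=> //; apply: (addrI S); rewrite -BB BM SE.
Qed.

(** [N] kills the image of [N^n], so powers of [c + N] act there as powers of [c], and the power [n]
    of the product is [c^n N^n]. *)
Lemma regular_nilpotent_shift n (N : 'M[k]_n.+1) c : c != 0 ->
  N ^+ n.+1 = 0 -> N ^+ n != 0 ->
  (N * (c%:M + N)) ^+ n.+1 = 0 /\ (N * (c%:M + N)) ^+ n != 0.
Proof.
move=> c0 Nn Nn'; have cN := comm_scalar_addr N c.
split; first by rewrite exprMn_comm // Nn mul0r.
have cNn i : N ^+ n * (c%:M + N) ^+ i = c ^+ i *: N ^+ n.
  elim: i => [|i IHi]; first by rewrite mulr1 scale1r.
  rewrite exprS mulrA mulrDr -exprSr Nn addr0 -!mulmxE scalar_mxC mul_scalar_mx.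
  by rewrite -scalemxAl mulmxE IHi scalerA exprS.
by rewrite exprMn_comm // cNn scaler_eq0 expf_eq0 (negPf c0) andbF.
Qed.

End JordanParts.

(** * Indecomposable k[x]-modules *)

Section KxModule.
Variable k : fieldType.

(** Equality would force both components of the action to be square and invertible, against
    nilpotency. *)
Lemma kx_rank_lt (W : kxmod k) m : (kx_x10 W *m kx_x01 W) ^+ m = 0 -> ~ kx_zero W ->
  (\rank (kx_x10 W) + \rank (kx_x01 W) < kx_dim0 W + kx_dim1 W)%N.
Proof.
case: W => d0 d1 x10 x01 /= nil nz; rewrite ltnNge; apply/negP => le.
have {}nz : (0 < d0 + d1)%N.
  by rewrite lt0n addn_eq0; apply/negP => /andP[/eqP z0 /eqP z1]; apply: nz.
have := (rank_leq_row x10, rank_leq_col x10, rank_leq_row x01, rank_leq_col x01).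
move=> [[[r10 c10] r01] c01]; have d01 : d0 = d1 by lia.
subst d1; have u10 : x10 \in unitmx by rewrite -row_full_unit /row_full; lia.
have u01 : x01 \in unitmx by rewrite -row_full_unit /row_full; lia.
have : (x10 *m x01) ^+ m \in unitmx.
  elim: (m) => [|i IHi]; first by rewrite expr0 unitmx1.
  by rewrite exprS -mulmxE !unitmx_mul u10 u01.
rewrite nil unitmxE; case: d0 nz {x10 x01 le nil r10 c10 r01 c01 u10 u01} => // d0 _.
by rewrite det0 unitr0.
Qed.

(** The total rank falls short of the dimension by 1 only, whereas each nonzero summand accounts for
    a defect of at least 1. *)
Lemma kx_indecomposable_chain (W : kxmod k) m :
  (kx_x10 W *m kx_x01 W) ^+ m = 0 ->
  (\rank (kx_x10 W) + \rank (kx_x01 W)).+1 = (kx_dim0 W + kx_dim1 W)%N ->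
  kx_indecomposable W.
Proof.
move=> nil rk; split=> [[z0 z1]|W1 W2 [u0 [u1 [v0 [v1 [[uv0 vu0] [uv1 vu1] e10 e01]]]]]].
  by move/eqP: rk; rewrite [X in _ == X](congr2 addn z0 z1).
have d0E := mulmx1_dim uv0 vu0; have d1E := mulmx1_dim uv1 vu1.
have r10 : (\rank (kx_x10 W) <= \rank (kx_x10 W1) + \rank (kx_x10 W2))%N.
  rewrite -rank_diag_block_mx -[kx_x10 W]mul1mx -vu0 -mulmxA e10.
  by rewrite (leq_trans (mxrankM_maxr _ _)) ?mxrankM_maxl.
have r01 : (\rank (kx_x01 W) <= \rank (kx_x01 W1) + \rank (kx_x01 W2))%N.
  rewrite -rank_diag_block_mx -[kx_x01 W]mul1mx -vu1 -mulmxA e01.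
  by rewrite (leq_trans (mxrankM_maxr _ _)) ?mxrankM_maxl.
have [nil1 nil2] : (kx_x10 W1 *m kx_x01 W1) ^+ m = 0 /\ (kx_x10 W2 *m kx_x01 W2) ^+ m = 0.
  have := mulmx_block (kx_x10 W1) 0 0 (kx_x10 W2) (kx_x01 W1) 0 0 (kx_x01 W2).
  rewrite !(mul0mx, mulmx0, addr0, add0r) => bE.
  have : block_mx (kx_x10 W1 *m kx_x01 W1) 0 0 (kx_x10 W2 *m kx_x01 W2) ^+ m = 0.
    rewrite -bE; apply: (similar_nilp (u := v0) (v := u0) uv0 _ nil).
    have e : u0 *m (kx_x10 W *m kx_x01 W) =
        block_mx (kx_x10 W1) 0 0 (kx_x10 W2) *m block_mx (kx_x01 W1) 0 0 (kx_x01 W2) *m u0.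
      by rewrite mulmxA e10 -mulmxA e01 mulmxA.
    by rewrite -[LHS]mulmx1 -uv0 mulmxA -[v0 *m _ *m u0]mulmxA -e [v0 *m _]mulmxA vu0 mul1mx.
  by rewrite block_diagX -[RHS]block_mx0 => /eq_block_mx[].
have lt1 := kx_rank_lt nil1; have lt2 := kx_rank_lt nil2.
have nz V : kx_zero V \/ ~ @kx_zero k V.
  by rewrite /kx_zero; case: (kx_dim0 V) (kx_dim1 V) => [|?] [|?]; [left | right; case..].
have [z1|/lt1 {}lt1] := nz W1; first by left.
have [z2|/lt2 {}lt2] := nz W2; first by right.
rewrite /= in d0E d1E; lia.
Qed.

End KxModule.

Section Splitting.
Variable k : fieldType.

Lemma rank_jordan_block n : \rank (jordan_block k n.+1) = n.
Proof.
set J := jordan_block k n.+1; have lt_r : (\rank J < n.+1)%N.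
  rewrite ltn_neqAle rank_leq_row andbT; apply/negP => rJ.
  have uJ : J \in unitmx by rewrite -row_free_unit.
  have uJX i : J ^+ i \in unitmx.
    by elim: i => [|i IHi]; rewrite ?expr0 ?unitmx1 // exprS -mulmxE unitmx_mul uJ.
  by have := uJX n.+1; rewrite jordan_block_nilp unitmxE det0 unitr0.
have : (\rank (kermx J) <= 1)%N.
  rewrite -[X in (_ <= X)%N](mxrank_delta k (0 : 'I_1) (ord_max : 'I_n.+1)) mxrankS //.
  apply/rV_subP => u /sub_kermxP/rowP uJ; apply/submxP; exists (u 0 ord_max)%:M.
  rewrite mul_scalar_mx; apply/rowP => j; rewrite !mxE eqxx /=.
  have [->|ne_j] := eqVneq j ord_max; first by rewrite mulr1.
  have lt_j : (j.+1 < n.+1)%N by rewrite ltnS ltn_neqAle -ltnS ltn_ord andbT.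
  have := uJ (Ordinal lt_j); rewrite mulr0 !mxE (bigD1 j) //= big1 => [|l ne_l].
    by rewrite mxE eqxx mulr1 addr0.
  by rewrite mxE eqSS val_eqE (negPf ne_l) mulr0.
by rewrite mxrank_ker; lia.
Qed.

Lemma idempotent_split n (P : 'M[k]_n) : P * P = P ->
  exists d (A : 'M[k]_(d, n)) (R : 'M[k]_(n, d)), A *m R = 1%:M /\ R *m A = P.
Proof.
move=> PP; pose A := row_base P; exists (\rank P), A, (P *m pinvmx A).
have AP : A *m P = A.
  have /submxP[c ->] : (A <= P)%MS by rewrite eq_row_base.
  by rewrite -mulmxA mulmxE PP.
split; first by rewrite mulmxA AP mulmxVp ?row_base_free.
by rewrite mulmxKpV // eq_row_base.
Qed.

(** [N] exchanges the images of [P0] and [P1]. [W] takes its even part from [P0] and its odd part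
    from [P1]; the remaining halves form its parity shift. *)
Lemma kx_split n (N P0 P1 : 'M[k]_n) :
  P0 * P0 = P0 -> P1 * P1 = P1 -> P0 + P1 = 1 -> P0 * N = N * P1 -> P1 * N = N * P0 ->
  N ^+ n = 0 -> (\rank N).+1 = n ->
  exists W : kxmod k,
    [/\ kx_indecomposable W, kx_indecomposable (kx_Pi W)
      & kx_iso (KxMod N N) (kx_sum W (kx_Pi W))].
Proof.
move=> PP0 PP1 P01 PN0 PN1 Nn rkN.
have P0P1 : P0 * P1 = 0 by rewrite -[P1](addKr P0) P01 mulrDr mulrN PP0 mulr1 addNr.
have P1P0 : P1 * P0 = 0 by rewrite -[P0](addrK P1) P01 mulrBr PP1 mulr1 subrr.
have [d0 [A0 [R0 [AR0 RA0]]]] := idempotent_split PP0.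
have [d1 [A1 [R1 [AR1 RA1]]]] := idempotent_split PP1.
rewrite -!mulmxE in P0P1 P1P0 PN0 PN1.
have AP0 : A0 *m P0 = A0 by rewrite -RA0 mulmxA AR0 mul1mx.
have AP1 : A1 *m P1 = A1 by rewrite -RA1 mulmxA AR1 mul1mx.
have PR0 : P0 *m R0 = R0 by rewrite -RA0 -mulmxA AR0 mulmx1.
have PR1 : P1 *m R1 = R1 by rewrite -RA1 -mulmxA AR1 mulmx1.
have A0R1 : A0 *m R1 = 0 by rewrite -AP0 -PR1 mulmxA -[A0 *m _ *m _]mulmxA P0P1 mulmx0 mul0mx.
have A1R0 : A1 *m R0 = 0 by rewrite -AP1 -PR0 mulmxA -[A1 *m _ *m _]mulmxA P1P0 mulmx0 mul0mx.
pose x10 := A0 *m N *m R1; pose x01 := A1 *m N *m R0.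
have x10A : x10 *m A1 = A0 *m N by rewrite -mulmxA RA1 -mulmxA -PN0 mulmxA AP0.
have x01A : x01 *m A0 = A1 *m N by rewrite -mulmxA RA0 -mulmxA -PN1 mulmxA AP1.
(* [C0] gives the even coordinates and [C1] the odd ones, in opposite orders, so that [N] becomes
   block diagonal. *)
pose C0 := col_mx A0 A1; pose D0 := row_mx R0 R1.
pose C1 := col_mx A1 A0; pose D1 := row_mx R1 R0.
have CD0 : C0 *m D0 = 1%:M by rewrite mul_col_row AR0 AR1 A0R1 A1R0 -scalar_mx_block.
have CD1 : C1 *m D1 = 1%:M by rewrite mul_col_row AR0 AR1 A0R1 A1R0 -scalar_mx_block.
have DC0 : D0 *m C0 = 1%:M by rewrite mul_row_col RA0 RA1 P01.
have DC1 : D1 *m C1 = 1%:M by rewrite mul_row_col RA0 RA1 addrC P01.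
have C0N : C0 *m N = block_mx x10 0 0 x01 *m C1.
  by rewrite mul_col_mx mul_block_col !mul0mx addr0 add0r x10A x01A.
have C1N : C1 *m N = block_mx x01 0 0 x10 *m C0.
  by rewrite mul_col_mx mul_block_col !mul0mx addr0 add0r x10A x01A.
have dE : (d0 + d1)%N = n := mulmx1_dim CD0 DC0.
have rk : (\rank x10 + \rank x01).+1 = (d0 + d1)%N.
  rewrite dE -{}rkN -rank_diag_block_mx; congr _.+1; apply/eqP; rewrite eqn_leq; apply/andP; split.
    rewrite -[block_mx _ _ _ _]mulmx1 -CD1 mulmxA -C0N.
    by rewrite (leq_trans (mxrankM_maxl _ _)) ?mxrankM_maxr.
  rewrite -{1}[N]mul1mx -DC0 -mulmxA C0N.
  by rewrite (leq_trans (mxrankM_maxr _ _)) ?mxrankM_maxl.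
have nilp d d' (A : 'M_(d, n)) (A' : 'M_(d', n)) R R' P P' :
    A *m R = 1%:M -> R *m A = P :> 'M_n -> R' *m A' = P' :> 'M_n ->
    P *m N = N *m P' -> P' *m N = N *m P -> P' *m R' = R' -> P *m R = R ->
    (A *m N *m R' *m (A' *m N *m R)) ^+ n = 0.
  move=> AR RA RA' PN PN' PR' PR; apply: (similar_nilp (u := R) (v := A) (T' := N * N) AR).
    rewrite !mulmxA RA PN -[N *m P' *m R']mulmxA PR' -[N *m R' *m A']mulmxA RA'.
    by rewrite -[N *m P' *m N]mulmxA PN' -!mulmxA PR mulmxA.
  by rewrite exprMn_comm // Nn mul0r.
exists (KxMod x10 x01); split.
- apply: (@kx_indecomposable_chain _ _ n); last exact: rk.
  exact: (nilp _ _ _ _ _ _ _ _ AR0 RA0 RA1 PN0 PN1 PR1 PR0).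
- apply: (@kx_indecomposable_chain _ _ n); last by rewrite /= addnC rk addnC.
  exact: (nilp _ _ _ _ _ _ _ _ AR1 RA1 RA0 PN1 PN0 PR0 PR1).
by exists C0, C1, D0, D1.
Qed.

(** [P b] projects onto the Jordan basis vectors whose index has parity [b], and [N] changes this
    parity. *)
Lemma regular_nilpotent_kx_split n (N : 'M[k]_n.+1) : N ^+ n.+1 = 0 -> N ^+ n != 0 ->
  exists W : kxmod k,
    [/\ kx_indecomposable W, kx_indecomposable (kx_Pi W)
      & kx_iso (KxMod N N) (kx_sum W (kx_Pi W))].
Proof.
move=> Nn Nn1; have [u uU uN] := nilpotent_regular_jordan (ltn0Sn n) Nn Nn1.
set J := jordan_block k n.+1 in uN.
pose D b : 'M[k]_n.+1 := diag_mx (\row_j (odd j == b)%:R).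
pose P b := invmx u *m D b *m u.
have DD b : D b *m D b = D b.
  rewrite mul_diag_mx; apply/matrixP => i j; rewrite !mxE.
  by case: (odd i == b); rewrite ?mul1r ?mul0r ?mul0rn.
have DJ b : D b *m J = J *m D (~~ b).
  rewrite mul_diag_mx mul_mx_diag; apply/matrixP => i j; rewrite !mxE.
  case: (eqVneq i.+1 (j : nat)) => [<-|_]; last by rewrite mulr0 mul0r.
  by rewrite mulr1 mul1r /=; case: (odd i); case: b.
have NE : N = invmx u *m J *m u by rewrite -mulmxA -uN mulKmx.
have PP b : P b * P b = P b.
  by rewrite -mulmxE /P !mulmxA mulmxK // -[_ *m D b *m D b]mulmxA DD.
have PN b : P b * N = N * P (~~ b).
  rewrite -!mulmxE /P NE !mulmxA !mulmxK //.
  by rewrite -[invmx u *m D b *m J]mulmxA DJ mulmxA.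
apply: (@kx_split _ N (P false) (P true)) => //; try exact: PN.
  rewrite /P -mulmxDl -mulmxDr (_ : D false + D true = 1%:M); first by rewrite mulmx1 mulVmx.
  apply/matrixP => i j; rewrite !mxE -mulrnDl; congr (_ *+ _).
  by case: (odd i); rewrite ?addr0 ?add0r.
rewrite NE mxrankMfree ?row_free_unit // eqmxMfull ?row_full_unit ?unitmx_inv //.
by rewrite rank_jordan_block.
Qed.

End Splitting.

(** * The three assertions, read off from [B = mu + N] *)

Theorem lemma7p5p2 (k : closedFieldType) (char0 : [pchar k] =i pred0)
    (n : nat) (n_gt0 : (0 < n)%N) (x s f : 'M[k]_(n + n))
    (x_queer : queer x) (x_odd : has_parity true x) (x_dist : distinguished x)
    (x2_dec : jordan_decomposition (2%:R^-1 *: sbracket x x) s f) :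
  (* (1) *)
  (exists lambda : k, s = lambda%:M) /\
  (* (2) *)
  (s != 0 ->
     queer_even_principal_nilpotent f /\
     forall e h : 'M[k]_(n + n),
       queer e -> has_parity false e -> queer h -> has_parity false h ->
       sl2_triple e h f ->
       exists xs : 'I_n -> 'M[k]_(n + n),
         x = \sum_(i < n) xs i /\
         forall i : 'I_n,
           [/\ queer (xs i), has_parity true (xs i)
             & sbracket h (xs i) = - ((2 * i)%:R *: xs i)]) /\
  (* (3) *)
  (s = 0 ->
     (exists W : kxmod k,
        [/\ kx_indecomposable W, kx_indecomposable (kx_Pi W)
          & kx_iso (kxmod_of x) (kx_sum W (kx_Pi W))]) /\
     (odd n -> neat x) /\
     (~~ odd n -> balanced x)).
Proof.
case: n n_gt0 x s f x_queer x_odd x_dist x2_dec => // n _ x s f x_queer x_odd.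
rewrite (queer_oddP x_queer x_odd); set B := ursubmx x => dist.
have two_neq0 : (2%:R : k) != 0 by rewrite pchar0_natr_eq0.
case=> + [s_queer s_even S_diag] [f_queer f_even [j Fj]].
rewrite (queer_evenP s_queer s_even) (queer_evenP f_queer f_even).
set S := ulsubmx s in S_diag *; set F := ulsubmx f in Fj *.
rewrite sbracket_odd_odd sbracket_even_even -mulr2n -scaler_nat -queer_evenZ scalerA.
rewrite mulVf // scale1r queer_evenD => /queer_even_inj BB.
move=> SF0; have SF : S * F = F * S.
  move: SF0; rewrite /queer_even -[RHS]block_mx0 => /eq_block_mx[/eqP + _ _ _].
  by rewrite subr_eq0 => /eqP.
have [mu [N [BE Nn Nn1]]] := distinguished_regular dist.
have [SE FE] := jordan_parts_sqr BE Nn S_diag Fj SF BB.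
have sE : queer_even S = (mu ^+ 2)%:M by rewrite SE /queer_even -scalar_mx_block.
split; first by exists (mu ^+ 2).
split=> [s_neq0 | s0].
  have mu_neq0 : mu != 0.
    by apply: contra_neq s_neq0 => mu0; rewrite sE mu0 expr0n /= raddf0.
  have [Fn Fn1] := regular_nilpotent_shift (mulf_neq0 two_neq0 mu_neq0) Nn Nn1.
  rewrite -FE in Fn Fn1.
  have [v vF] := regular_nilpotent_cyclic (ltn0Sn n) Fn Fn1.
  split.
    split; first by split; [exact: queer_even_queer | exact: queer_even_parity
                           | rewrite block_mxKul; exists j].
    (* The centralizer of the cyclic matrix [F] has dimension at most [n + 1], a lower bound for
       every centralizer. *)
    by move=> A; rewrite block_mxKul (leq_trans (rank_cent_cyclic vF)) ?rank_cent_ge.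
  move=> e h _ _ h_queer h_even [_ + _].
  rewrite (queer_evenP h_queer h_even); set H := ulsubmx h.
  rewrite sbracket_even_even queer_evenZ => HF.
  have {}HF : H * F = F * H + - 2%:R *: F.
    move: HF; rewrite /queer_even opp_block_mx => /eq_block_mx[/eqP + _ _ _].
    by rewrite subr_eq addrC scaleNr => /eqP.
  have BF : B * F = F * B.
    have -> : F = B * B - S by rewrite BB addrC addKr.
    by rewrite mulrBr mulrBl mulrA SE -!mulmxE scalar_mxC.
  (* [B] commutes with the cyclic matrix [F], so it is a polynomial in [F]; its terms are the weight
     components. *)
  have [c BcF] := cent_cyclic_poly vF BF.
  exists (fun i => queer_odd (c i *: F ^+ i)); split.
    by rewrite BcF (big_morph (@queer_odd k n.+1) (id1 := 0) (op1 := +%R)) //= => [X Y|];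
      rewrite ?queer_oddD // /queer_odd block_mx0.
  move=> i; split; [exact: queer_odd_queer | exact: queer_odd_parity |].
  rewrite sbracket_even_odd queer_oddZ -!mulmxE -scalemxAl -scalemxAr !mulmxE.
  rewrite (mulr_exp_commutator _ HF) scalerDr addrAC subrr add0r -scaleN1r queer_oddZ.
  by rewrite !scalerA natrM; congr (queer_odd (_ *: _)); ring.
(* Here [s] is the scalar [mu^2], so [B] is the regular nilpotent [N] itself. *)
have mu0 : mu = 0.
  move: s0; rewrite sE => /matrixP/(_ 0 0); rewrite !mxE eqxx mulr1n => /eqP.
  by rewrite expf_eq0 => /eqP.
have {}BE : B = N by rewrite BE mu0 raddf0 add0r.
rewrite -BE in Nn Nn1; split; last split.
- have := regular_nilpotent_kx_split Nn Nn1.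
  by rewrite /kxmod_of block_mxKur block_mxKdl.
- by move=> odd_n; apply: odd_regular_neat.
by move=> even_n; apply: even_regular_balanced.
Qed.
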